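(* Under Assumption A, the limit curve of the sandpile $$\mathcal C=\left\{\frac{u}{\Gamma^{-1}(u)\cdot u}: u\in\mathbb S^{d-1}\right\}$$ and the set $\partial\mathcal T=\{t\in\mathbb R^d:\rho(t)=1\}$ are dual curves, i.e. $\mathcal C=(\partial\mathcal T)^*$.
   Context: Setting. $d,p\ge1$ are integers. For $x\in\mathbb Z^d$, $i,j\in\{1,\dots,p\}$ let $c(x,i,j)\ge 0$, with $0<\sigma_i:=\sum_{(y,j)}c(y,i,j)<\infty$, and let $m_i\ge1$ be leakiness parameters. Put $\mu_{i,j}(x)=\frac{c(x,i,j)}{m_i\sigma_i}$. The killed random walk (KRW) $(X_n)$ on $(\mathbb Z^d\times\{1,\dots,p\})\sqcup\{\mathsf k\}$ jumps from $(x,i)$ to $(y,j)$ with probability $\mu_{i,j}(y-x)$ and from $(x,i)$ to the absorbing cemetery $\mathsf k$ with probability $1-\frac1{m_i}$. Assumption A: (1) $m_i>1$ for at least one $i$; (2) the KRW is irreducible: every $(x,j)$ can be reached from every $(0,i)$ with positive probability in some number $n\ge1$ of steps; (3) it is aperiodic: $\gcd\{n\ge1:\mathbb P_{(x,i)}(X_n=(x,i))>0\}=1$ for all $(x,i)$; (4) $\sum_{x}e^{\gamma\|x\|}\mu_{i,j}(x)<\infty$ for all $i,j$ and all $\gamma>0$. For $t\in\mathbb R^d$ let $L\mu(t)$ be the $p\times p$ matrix with entries $\sum_{x\in\mathbb Z^d}e^{t\cdot x}\mu_{i,j}(x)$ and $\rho(t)$ its spectral radius; $\mathcal T=\{t:\rho(t)\le1\}$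 is a compact convex set with $0$ in its interior and boundary $\partial\mathcal T=\{t:\rho(t)=1\}$. The map $\Gamma:\partial\mathcal T\to\mathbb S^{d-1}$, $\Gamma(t)=\nabla\rho(t)/\|\nabla\rho(t)\|$, is a homeomorphism (known result), and $\Gamma^{-1}(u)\cdot u>0$ for all $u$. Dual curve. For $K\subset\mathbb R^d$ compact convex with $0$ in its interior and $x\in\partial K$, the normal cone is $N_K(x)=\{n\in\mathbb R^d: n\cdot(y-x)\le0\ \forall y\in K\}$, and $x^*=\{z\in N_K(x): z\cdot x=1\}=\{\frac{n}{n\cdot x}:n\in N_K(x)\setminus\{0\}\}$. The dual curve of $\partial K$ is $(\partial K)^*=\bigcup_{x\in\partial K}x^*$. *)

(* Defs.v *)
From HB Require Import structures.
From mathcomp Require Import all_boot all_order all_algebra.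
From mathcomp Require Import all_classical all_reals all_analysis.
From mathcomp Require Import complex.

Set Implicit Arguments.
Unset Strict Implicit.
Unset Printing Implicit Defensive.

Import Order.TTheory GRing.Theory Num.Theory.
Import numFieldNormedType.Exports.

Local Open Scope classical_set_scope.
Local Open Scope ring_scope.

(* MathComp-Analysis, over an abstract [R : realType].  Points of Z^d and R^d
   are row vectors; the norm [`|_|] provided by the library on row vectors is
   the sup norm, hence the explicit Euclidean structure below. *)

Definition dotv (R : realType) (d : nat) (u v : 'rV[R]_d) : R :=
  \sum_(k < d) u ord0 k * v ord0 k.

Definition enorm (R : realType) (d : nat) (u : 'rV[R]_d) : R :=
  Num.sqrt (dotv u u).

Definition unit_sphere (R : realType) (d : nat) : set 'rV[R]_d :=
  [set u | enorm u = 1].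

Definition gradient (R : realType) (d : nat) (f : 'rV[R]_d -> R)
    (t : 'rV[R]_d) : 'rV[R]_d :=
  \row_k 'D_(delta_mx ord0 k) f t.

Definition zvec (R : realType) (d : nat) (x : 'rV[int]_d) : 'rV[R]_d :=
  map_mx intr x.
Arguments zvec R {d} x.

(* Largest modulus of a complex eigenvalue. *)
Definition spectral_radius (R : realType) (p : nat) (A : 'M[R]_p) : R :=
  sup [set ComplexField.Normc.normc z | z in
        [set z : complex R | eigenvalue (map_mx (real_complex R) A) z]].

(* [g] is the gcd of the (possibly infinite) set [S]; the gcd of a set
   contained in {0} is 0. *)
Definition is_gcd_of (S : set nat) (g : nat) : Prop :=
  (forall n, S n -> (g %| n)%N) /\
  (forall e, (forall n, S n -> (e %| n)%N) -> (e %| g)%N).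

Definition sigma (R : realType) (d p : nat)
    (c : 'rV[int]_d -> 'I_p -> 'I_p -> R) (i : 'I_p) : \bar R :=
  (\esum_(yj in [set: 'rV[int]_d * 'I_p]) (c yj.1 i yj.2)%:E)%E.

Definition mu (R : realType) (d p : nat)
    (c : 'rV[int]_d -> 'I_p -> 'I_p -> R) (m : 'I_p -> R)
    (i j : 'I_p) (x : 'rV[int]_d) : R :=
  c x i j / (m i * fine (sigma c i)).

(* [None] is the cemetery. *)
Notation state d p := (option ('rV[int]_d * 'I_p)%type).

Definition krw_step (R : realType) (d p : nat)
    (c : 'rV[int]_d -> 'I_p -> 'I_p -> R) (m : 'I_p -> R)
    (a b : state d p) : R :=
  match a, b with
  | Some (x, i), Some (y, j) => mu c m i j (y - x)
  | Some (_, i), None => 1 - (m i)^-1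
  | None, Some _ => 0
  | None, None => 1
  end.

(* [krw_prob c m n a b] is P_a(X_n = b). *)
Fixpoint krw_prob (R : realType) (d p : nat)
    (c : 'rV[int]_d -> 'I_p -> 'I_p -> R) (m : 'I_p -> R)
    (n : nat) (a b : state d p) : \bar R :=
  if n is n'.+1 then
    (\esum_(s in [set: state d p])
        ((krw_step c m a s)%:E * krw_prob c m n' s b))%E
  else ((a == b)%:R)%:E.

Record assumption_A (R : realType) (d p : nat)
    (c : 'rV[int]_d -> 'I_p -> 'I_p -> R) (m : 'I_p -> R) : Prop := {
  A_leaky : exists i, 1 < m i;
  A_irreducible : forall (i j : 'I_p) (x : 'rV[int]_d),
    exists n : nat, (1 <= n)%N /\
      (0 < krw_prob c m n (Some (0%R, i)) (Some (x, j)))%E;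
  A_aperiodic : forall (x : 'rV[int]_d) (i : 'I_p),
    is_gcd_of
      [set n : nat | (1 <= n)%N /\
        (0 < krw_prob c m n (Some (x, i)) (Some (x, i)))%E] 1%N;
  A_exp_moments : forall (i j : 'I_p) (gamma : R), 0 < gamma ->
    (\esum_(x in [set: 'rV[int]_d])
       (expR (gamma * enorm (zvec R x)) * mu c m i j x)%:E < +oo)%E
}.

(* [fine] is harmless under the exponential moment condition, which makes the
   sum finite for every [t]. *)
Definition Lmu (R : realType) (d p : nat)
    (c : 'rV[int]_d -> 'I_p -> 'I_p -> R) (m : 'I_p -> R)
    (t : 'rV[R]_d) : 'M[R]_p :=
  \matrix_(i, j) fine (\esum_(x in [set: 'rV[int]_d])
                         (expR (dotv t (zvec R x)) * mu c m i j x)%:E)%E.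

Definition rho (R : realType) (d p : nat)
    (c : 'rV[int]_d -> 'I_p -> 'I_p -> R) (m : 'I_p -> R)
    (t : 'rV[R]_d) : R :=
  spectral_radius (Lmu c m t).

Definition calT (R : realType) (d p : nat)
    (c : 'rV[int]_d -> 'I_p -> 'I_p -> R) (m : 'I_p -> R) : set 'rV[R]_d :=
  [set t | rho c m t <= 1].

(* The level set {rho = 1}, on which Gamma is defined. *)
Definition bdT (R : realType) (d p : nat)
    (c : 'rV[int]_d -> 'I_p -> 'I_p -> R) (m : 'I_p -> R) : set 'rV[R]_d :=
  [set t | rho c m t = 1].

Definition Gamma (R : realType) (d p : nat)
    (c : 'rV[int]_d -> 'I_p -> 'I_p -> R) (m : 'I_p -> R)
    (t : 'rV[R]_d) : 'rV[R]_d :=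
  (enorm (gradient (rho c m) t))^-1 *: gradient (rho c m) t.

(* Inverse of the restriction of Gamma to {rho = 1}. *)
Definition Gamma_inv (R : realType) (d p : nat)
    (c : 'rV[int]_d -> 'I_p -> 'I_p -> R) (m : 'I_p -> R) :
    'rV[R]_d -> 'rV[R]_d :=
  pinv (bdT c m) (Gamma c m).

Definition limit_curve (R : realType) (d p : nat)
    (c : 'rV[int]_d -> 'I_p -> 'I_p -> R) (m : 'I_p -> R) : set 'rV[R]_d :=
  [set (dotv (Gamma_inv c m u) u)^-1 *: u | u in @unit_sphere R d].

Definition frontier (R : realType) (d : nat) (K : set 'rV[R]_d) :
    set 'rV[R]_d :=
  closure K `\` interior K.

Definition normal_cone (R : realType) (d : nat) (K : set 'rV[R]_d)
    (x : 'rV[R]_d) : set 'rV[R]_d :=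
  [set n | forall y, K y -> dotv n (y - x) <= 0].

Definition dual_points (R : realType) (d : nat) (K : set 'rV[R]_d)
    (x : 'rV[R]_d) : set 'rV[R]_d :=
  [set z | normal_cone K x z /\ dotv z x = 1].

(* The dual curve of the frontier of [K], for [K] compact and convex with 0 in
   its interior. *)
Definition dual_curve (R : realType) (d : nat) (K : set 'rV[R]_d) :
    set 'rV[R]_d :=
  \bigcup_(x in frontier K) dual_points K x.

(* Main.v *)
(* The Perron root [rho] of [Lmu] is a convex function with a quadratic expansion
   at every point, and this is all that the duality uses.

   Let [l], [r] be the positive left and right Perron vectors of [Lmu t].  From
   [e^b >= e^a (1 + b - a)], applied after tilting by the ratio of the Perron
   vectors at [y] and at [t], averaging with the weights [l_i r_j] gives
   [rho y >= rho t + g . (y - t)] with [g = l (Lmu' t) r / (l r)].  The reverse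
   bound [rho (t + v) <= rho t + g . v + C |v|^2] comes from the test vector
   [r_j e^{eta_j v}], where [eta] is linear and cancels the first order error; it
   exists by the Fredholm alternative, the left kernel of [Lmu t - rho t] being
   spanned by [l].  So [g] is the gradient of [rho] at [t].

   If [rho t = 1], then taking [y] in [calT] shows that [g] is normal to [calT] at
   [t], and taking [y = 0] shows that [g . t >= 1 - rho 0 > 0].  Differentiability
   makes the normal cone at [t] the ray spanned by [g], so [t^*] is the single
   point [Gamma t / (Gamma t . t)].  Every unit vector [u] is [Gamma t] for a
   maximizer [t] of [u . t] over the compact set [calT].  Finally [t . u] is the
   value at [u] of the support function of [calT] for every [t] in [Gamma^-1 u],
   so neither the injectivity of [Gamma] nor the convexity of [calT] is used. *)
Require Import Defs.
From mathcomp Require Import all_boot all_order all_algebra.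
From mathcomp Require Import all_classical all_reals all_analysis.
From mathcomp Require Import complex ring lra.

Set Implicit Arguments.
Unset Strict Implicit.
Unset Printing Implicit Defensive.

Import Order.TTheory GRing.Theory Num.Theory.
Import numFieldNormedType.Exports.

Local Open Scope classical_set_scope.
Local Open Scope ring_scope.

(** * Sums of signed families *)

(** One inequality is checked on finite partial sums; the other is the same inequality for the
    scalar [k^-1] and the family [k * f]. *)
Lemma esumZ (R : realType) (T : choiceType) (k : R) (f : T -> R) :
  0 <= k -> (forall x, 0 <= f x) ->
  (\esum_(x in setT) (k * f x)%:E = k%:E * \esum_(x in setT) (f x)%:E)%E.
Proof.
move=> k0 f0.
have le_ (c : R) (g : T -> R) : 0 <= c -> (forall x, 0 <= g x) ->
    (\esum_(x in setT) (c * g x)%:E <= c%:E * \esum_(x in setT) (g x)%:E)%E.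
  move=> c0 g0; apply: ge_ereal_sup => /= _ [X [finX _] <-].
  under eq_fsbigr do rewrite EFinM.
  rewrite -ge0_mule_fsumr => [|x]; last by rewrite lee_fin.
  by apply: lee_wpmul2l; rewrite ?lee_fin// esum_ge//; exists X.
have [->|kn0] := eqVneq k 0.
  by rewrite mul0e esum1// => x _; rewrite mul0r.
apply/eqP; rewrite eq_le le_//=.
have {}k0 : 0 < k by rewrite lt_neqAle eq_sym kn0.
have := le_ k^-1 (fun x => k * f x) _ _.
rewrite invr_ge0 ltW// => /(_ isT) /(_ (fun x => mulr_ge0 (ltW k0) (f0 x))).
under eq_esum do rewrite mulKf//.
move=> /(lee_wpmul2l (x := k%:E)); rewrite lee_fin ltW// => /(_ isT).
by rewrite muleA -EFinM divff// mul1e.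
Qed.

Definition rsummable (R : realType) (T : choiceType) (f : T -> R) : Prop :=
  summable setT (EFin \o f).

(** The derivatives of [Lmu] sum coordinates of both signs, hence a signed sum. The value is
    meaningful for [rsummable] families only, because of [fine]. *)
Definition rsum (R : realType) (T : choiceType) (f : T -> R) : R :=
  fine (esum setT (EFin \o f)^\+ - esum setT (EFin \o f)^\-).

Lemma rsummable_le (R : realType) (T : choiceType) (f g : T -> R) :
  (forall x, `|f x| <= g x) -> rsummable g -> rsummable f.
Proof.
move=> fg; apply: le_lt_trans; apply: le_esum => x _ /=.
by rewrite lee_fin (le_trans (fg x))// ler_norm.
Qed.

Lemma rsummable_ge0 (R : realType) (T : choiceType) (f : T -> R) :
  (forall x, 0 <= f x) ->
  rsummable f <-> (\esum_(x in setT) (f x)%:E < +oo)%E.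
Proof.
move=> f0; rewrite /rsummable /summable.
by under eq_esum do rewrite /= ger0_norm//.
Qed.

Lemma esum_fin_num (R : realType) (T : choiceType) (f : T -> R) :
  (forall x, 0 <= f x) -> rsummable f ->
  \esum_(x in setT) (f x)%:E \is a fin_num.
Proof.
move=> f0 /(rsummable_ge0 f0) sf; rewrite ge0_fin_numE// esum_ge0// => x _.
by rewrite lee_fin.
Qed.

Lemma rsummableD (R : realType) (T : choiceType) (f g : T -> R) :
  rsummable f -> rsummable g -> rsummable (fun x => f x + g x).
Proof. exact: summableD. Qed.

Lemma rsummableZ (R : realType) (T : choiceType) (k : R) (f : T -> R) :
  rsummable f -> rsummable (fun x => k * f x).
Proof.
rewrite /rsummable /summable => sf.
under eq_esum do rewrite /= normrM.
by rewrite esumZ// lte_mul_pinfty// lee_fin.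
Qed.

Lemma rsummable_sum (R : realType) (T : choiceType) (n : nat)
    (f : 'I_n -> T -> R) :
  (forall k, rsummable (f k)) -> rsummable (fun x => \sum_k f k x).
Proof.
elim: n f => [|n IH] f sf.
  rewrite /rsummable /summable esum1// => x _ /=.
  by rewrite big_ord0 normr0.
rewrite (_ : (fun x => _) =
    fun x => (\sum_(k < n) f (widen_ord (leqnSn n) k) x) + f ord_max x).
  by apply: rsummableD; [apply: IH => k; exact: sf|exact: sf].
by apply/funext => x; rewrite big_ord_recr.
Qed.

Lemma rsumB_ge0 (R : realType) (T : choiceType) (f g : T -> R) :
  rsummable f -> rsummable g -> (forall x, 0 <= f x) -> (forall x, 0 <= g x) ->
  rsum (fun x => f x - g x) =
  fine (\esum_(x in setT) (f x)%:E) - fine (\esum_(x in setT) (g x)%:E).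
Proof.
move=> sf sg f0 g0.
rewrite /rsum (esumB sf sg (fun x _ => f0 x) (fun x _ => g0 x)).
by rewrite fineB// esum_fin_num.
Qed.

Lemma rsum_ge0E (R : realType) (T : choiceType) (f : T -> R) :
  rsummable f -> (forall x, 0 <= f x) ->
  rsum f = fine (\esum_(x in setT) (f x)%:E).
Proof.
move=> sf f0; have s0 : rsummable (fun x => 0 * f x) by exact: rsummableZ.
have := rsumB_ge0 sf s0 f0.
rewrite (_ : (fun x => f x - 0 * f x) = f) => [->|]; last 2 first.
- by move=> x; rewrite mul0r.
- by apply/funext => x; rewrite mul0r subr0.
by rewrite [X in _ - fine X]esum1 ?subr0// => x _; rewrite mul0r.
Qed.

(** Reduces the linearity of [rsum] to nonnegative families, through [rsumB_ge0]. *)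
Lemma rsummable_posneg (R : realType) (T : choiceType) (h : T -> R) :
  rsummable h -> exists p n : T -> R,
    [/\ rsummable p, rsummable n, forall x, 0 <= p x, forall x, 0 <= n x &
        h = fun x => p x - n x].
Proof.
  move=> sh; have sa : rsummable (fun x => `|h x|).
    by move: sh; rewrite /rsummable /summable; under eq_esum do rewrite /= -normr_id.
  exists (fun x => (`|h x| + h x) / 2), (fun x => (`|h x| - h x) / 2); split.
  - apply: (rsummable_le _ sa) => x; rewrite ger0_norm.
      by have := ler_norm (h x); lra.
    by have := ler_norm (- h x); rewrite normrN; lra.
  - apply: (rsummable_le _ sa) => x; rewrite ger0_norm.
      by have := ler_norm (- h x); rewrite normrN; lra.
    by have := ler_norm (h x); lra.
  - by move=> x; have := ler_norm (- h x); rewrite normrN; lra.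
  - by move=> x; have := ler_norm (h x); lra.
  - by apply/funext => x; field.
Qed.

Lemma rsumD (R : realType) (T : choiceType) (f g : T -> R) :
  rsummable f -> rsummable g ->
  rsum (fun x => f x + g x) = rsum f + rsum g.
Proof.
move=> /rsummable_posneg[p [n [sp sn p0 n0 ->]]] /rsummable_posneg[q [k [sq sk q0 k0 ->]]].
rewrite (_ : (fun x => _) = fun x => (p x + q x) - (n x + k x)); last first.
  by apply/funext => x; ring.
rewrite !rsumB_ge0//; [|exact: rsummableD|exact: rsummableD
  |by move=> x; exact: addr_ge0|by move=> x; exact: addr_ge0].
have fineD_ (a b : T -> R) : rsummable a -> rsummable b ->
    (forall x, 0 <= a x) -> (forall x, 0 <= b x) ->
    fine (\esum_(x in setT) (a x + b x)%:E) =
    fine (\esum_(x in setT) (a x)%:E) + fine (\esum_(x in setT) (b x)%:E).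
  move=> sa sb a0 b0; under eq_esum do rewrite EFinD.
  rewrite esumD//; last 2 first.
  - by move=> x _; rewrite lee_fin.
  - by move=> x _; rewrite lee_fin.
  by rewrite fineD// esum_fin_num.
by rewrite !fineD_//; ring.
Qed.

Lemma rsum_ge0 (R : realType) (T : choiceType) (f : T -> R) :
  rsummable f -> (forall x, 0 <= f x) -> 0 <= rsum f.
Proof.
by move=> sf f0; rewrite rsum_ge0E// fine_ge0// esum_ge0// => x _; rewrite lee_fin.
Qed.

Lemma le_rsum (R : realType) (T : choiceType) (f g : T -> R) :
  rsummable f -> rsummable g -> (forall x, f x <= g x) -> rsum f <= rsum g.
Proof.
move=> sf sg fg.
have sgf : rsummable (fun x => g x + -1 * f x).
  by apply: rsummableD => //; exact: rsummableZ.
rewrite (_ : g = fun x => f x + (g x + -1 * f x)); last first.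
  by apply/funext => x; ring.
rewrite rsumD// lerDl rsum_ge0// => x.
by rewrite mulN1r subr_ge0.
Qed.

Lemma rsumZ (R : realType) (T : choiceType) (k : R) (f : T -> R) :
  rsummable f -> rsum (fun x => k * f x) = k * rsum f.
Proof.
have Z_ge0 (c : R) (g : T -> R) : 0 <= c -> rsummable g ->
    rsum (fun x => c * g x) = c * rsum g.
  move=> c0 /rsummable_posneg[p [n [sp sn p0 n0 ->]]].
  rewrite (_ : (fun x => _) = fun x => c * p x - c * n x); last first.
    by apply/funext => x; ring.
  have fineZ (a : T -> R) : rsummable a -> (forall x, 0 <= a x) ->
      fine (\esum_(x in setT) (c * a x)%:E) =
      c * fine (\esum_(x in setT) (a x)%:E).
    by move=> sa a0; rewrite esumZ// fineM// esum_fin_num.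
  rewrite !rsumB_ge0//; last 4 first.
  - exact: rsummableZ.
  - exact: rsummableZ.
  - by move=> x; exact: mulr_ge0.
  - by move=> x; exact: mulr_ge0.
  by rewrite !fineZ//; ring.
(* For negative [k], the sums of [k * f] and [- k * f] add up to 0, and [- k] falls under the
   nonnegative case. *)
move=> sf; have [k0|/ltW k0] := leP 0 k; first exact: Z_ge0.
have s1 : rsummable (fun x => k * f x) by exact: rsummableZ.
have s2 : rsummable (fun x => - k * f x) by exact: rsummableZ.
have := rsumD s1 s2.
rewrite (_ : (fun x => _ + _) = fun x => 0 * f x); last first.
  by apply/funext => x; ring.
by rewrite !(Z_ge0 0, Z_ge0 (- k)) ?oppr_ge0// => E; lra.
Qed.

Lemma rsum_sum (R : realType) (T : choiceType) (n : nat)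
    (f : 'I_n -> T -> R) : (forall k, rsummable (f k)) ->
  rsum (fun x => \sum_k f k x) = \sum_k rsum (f k).
Proof.
elim: n f => [|n IH] f sf.
  rewrite big_ord0 (_ : (fun x => _) = fun x : T => 0 * 0); last first.
    by apply/funext => x; rewrite big_ord0 mulr0.
  rewrite rsumZ ?mul0r//.
  by rewrite /rsummable /summable esum1// => x _ /=; rewrite normr0.
rewrite (_ : (fun x => _) =
    fun x => (\sum_(k < n) f (widen_ord (leqnSn n) k) x) + f ord_max x).
  rewrite rsumD//; last exact: rsummable_sum.
  by rewrite IH// big_ord_recr.
by apply/funext => x; rewrite big_ord_recr.
Qed.

(** * Perron-Frobenius theory *)

Lemma exprmx_comm (R : realType) (p n : nat) (A : 'M[R]_p) :
  (A ^+ n) *m A = A *m (A ^+ n).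
Proof. by rewrite -[LHS]/((A ^+ n) * A) -exprSr exprS. Qed.

(** The exponent depends on the entry and may be 0, so the diagonal is unconstrained. *)
Definition mx_irreducible (R : realType) (p : nat) (A : 'M[R]_p) : Prop :=
  forall i j, exists n : nat, 0 < (A ^+ n) i j.

Lemma exprmx_ge0 (R : realType) (p n : nat) (A : 'M[R]_p) :
  (forall i j, 0 <= A i j) -> forall i j, 0 <= (A ^+ n) i j.
Proof.
move=> A0; elim: n => [|n IH] i j; first by rewrite expr0 mxE ler0n.
by rewrite exprS mxE sumr_ge0// => k _; rewrite mulr_ge0.
Qed.

Lemma mx_irreducible_tr (R : realType) (p : nat) (A : 'M[R]_p) :
  mx_irreducible A -> mx_irreducible A^T.
Proof.
move=> irrA i j; have [n An] := irrA j i; exists n.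
suff -> : A^T ^+ n = (A ^+ n)^T by rewrite mxE.
elim: n {An} => [|n IH]; first by rewrite !expr0 trmx1.
by rewrite exprS exprSr IH; exact: (esym (trmx_mul _ _)).
Qed.

(** [B] is a sum of powers of [A], one for each entry that has to be made positive. It turns nonzero
    nonnegative vectors into positive ones and preserves the eigenvector equation. *)
Lemma mx_irreducible_pos (R : realType) (p : nat) (A : 'M[R]_p) :
  (forall i j, 0 <= A i j) -> mx_irreducible A ->
  exists B : 'M[R]_p, B *m A = A *m B /\ forall i j, 0 < B i j.
Proof.
move=> A0 irr; pose irrA i j := cid (irr i j).
exists (\sum_i \sum_j A ^+ sval (irrA i j)); split.
  rewrite mulmx_suml mulmx_sumr; apply: eq_bigr => i _.
  rewrite mulmx_suml mulmx_sumr; apply: eq_bigr => j _.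
  exact: exprmx_comm.
move=> i j; rewrite summxE (bigD1 i)//= summxE (bigD1 j)//=.
rewrite -addrA ltr_wpDr//; last exact: svalP (irrA i j).
rewrite addr_ge0 ?sumr_ge0// => k _; first exact: exprmx_ge0.
by rewrite summxE sumr_ge0// => l _; exact: exprmx_ge0.
Qed.

Lemma closed_ge_fun (R : realType) (T : topologicalType) (f g : T -> R) :
  continuous f -> continuous g -> closed [set x | f x <= g x].
Proof.
move=> cf cg; rewrite (_ : mkset _ = (fun x => g x - f x) @^-1` [set y | 0 <= y]).
  apply: preimage_closed; last exact: closed_ge.
  by move=> x _; apply: cvgB; [exact: cg|exact: cf].
by apply/seteqP; split => x /=; rewrite subr_ge0.
Qed.

Lemma mulmx_pos (R : realType) (p : nat) (B : 'M[R]_p) (u : 'cV[R]_p) :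
  (forall i j, 0 < B i j) -> (forall i, 0 <= u i ord0) -> u != 0 ->
  forall i, 0 < (B *m u) i ord0.
Proof.
move=> B0 u0 /eqP un0 i; rewrite mxE.
have [k uk] : exists k, 0 < u k ord0.
  apply: contrapT => nk; apply: un0; apply/matrixP => k j; rewrite ord1 mxE.
  by apply: contrapT => /eqP ukn0; apply: nk; exists k; rewrite lt_neqAle eq_sym ukn0/=.
rewrite (bigD1 k)//= ltr_wpDr ?mulr_gt0// sumr_ge0// => j _.
by rewrite mulr_ge0// ltW.
Qed.

(** The Collatz-Wielandt extremal problem. By homogeneity [w] may be taken in the simplex, and the
    admissible pairs [(w, s)] then form a compact set on which [s] attains its maximum. *)
Lemma perron_maximizer (R : realType) (p : nat) (A : 'M[R]_p) :
  (0 < p)%N -> (forall i j, 0 <= A i j) ->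
  exists (w : 'cV[R]_p) (s : R), [/\ 0 <= s, forall i, 0 <= w i ord0, w != 0,
    forall i, s * w i ord0 <= (A *m w) i ord0 &
    forall (y : 'cV[R]_p) (t : R), 0 <= t -> (forall i, 0 <= y i ord0) ->
      y != 0 -> (forall i, t * y i ord0 <= (A *m y) i ord0) -> t <= s].
Proof.
move=> p0 A0; pose S := \sum_i \sum_j A i j.
pose simplex := [set w : 'rV[R]_p | (forall i, 0 <= w ord0 i) /\ \sum_i w ord0 i = 1].
pose sub := [set ws : 'rV[R]_p * R |
  forall i, ws.2 * ws.1 ord0 i <= \sum_j A i j * ws.1 ord0 j].
pose K := (simplex `*` `[0, S]) `&` sub.
have cw i : continuous (fun ws : 'rV[R]_p * R => ws.1 ord0 i).
  move=> ws; apply: (@continuous_comp _ _ _ fst (fun w : 'rV[R]_p => w ord0 i)).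
    exact: cvg_fst.
  exact: coord_continuous.
have csum n (T : topologicalType) (f : 'I_n -> T -> R) :
    (forall k, continuous (f k)) -> continuous (fun x => \sum_k f k x).
  elim: n f => [|n IH] f cf x.
    by under eq_fun do rewrite big_ord0; exact: cvg_cst.
  under eq_fun do rewrite big_ord_recr.
  by apply: cvgD; [apply: (IH (fun k => f (widen_ord (leqnSn n) k))) => k|];
    exact: cf.
have cK : compact K.
  apply: compact_closedI; last first.
    rewrite /sub (_ : mkset _ = \bigcap_(i in setT) [set ws : 'rV[R]_p * R |
        ws.2 * ws.1 ord0 i <= \sum_j A i j * ws.1 ord0 j]); last first.
      by apply/seteqP; split => ws /= h i; [move=> _; exact: h|exact: h].
    apply: closed_bigI => i _; apply: closed_ge_fun.
      by move=> ws; apply: cvgM; [exact: cvg_snd|exact: cw].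
    apply: csum => j ws; apply: cvgM; [exact: cvg_cst|exact: cw].
  apply: compact_setX; last exact: segment_compact.
  pose cube := [set w : 'rV[R]_p | forall i, `[0, 1]%classic (w ord0 i)].
  apply: (subclosed_compact (B := cube)).
  - rewrite /simplex (_ : mkset _ = (\bigcap_(i in setT) [set w : 'rV[R]_p |
        0 <= w ord0 i]) `&` ([set w : 'rV[R]_p | \sum_i w ord0 i <= 1] `&`
        [set w : 'rV[R]_p | 1 <= \sum_i w ord0 i])); last first.
      apply/seteqP; split => w /=.
        by move=> [w0 ->]; split => [i _|]; [exact: w0|].
      move=> [w0 [w1 w2]]; split => [i|]; first exact: w0.
      by apply/eqP; rewrite eq_le w1.
    have c1 i : continuous (fun w : 'rV[R]_p => w ord0 i) by exact: coord_continuous.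
    apply: closedI.
      by apply: closed_bigI => i _; apply: closed_ge_fun => //; exact: cst_continuous.
    apply: closedI; apply: closed_ge_fun => //; try exact: cst_continuous.
    + exact: csum.
    + exact: csum.
  - have := @rV_compact R p (fun=> `[0, 1]%classic) (fun=> @segment_compact _ 0 1); exact.
  - move=> w [w0 w1] i /=; rewrite in_itv/= w0/= -w1 (bigD1 i)//= lerDl.
    by rewrite sumr_ge0.
(* Summing the inequalities over [i], with coordinates at most 1 and of sum 1, bounds [t] by the sum
   of all entries. *)
have bound (w : 'rV[R]_p) (t : R) : simplex w -> sub (w, t) -> t <= S.
  move=> [w0 w1] /= sw; rewrite -[t]mulr1 -w1 mulr_sumr; apply: ler_sum => i _.
  apply: le_trans (sw i) _; apply: ler_sum => j _.
  by rewrite ler_piMr// -w1 (bigD1 j)//= lerDl sumr_ge0.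
have K0 : K !=set0.
  exists (\row_i p%:R^-1, 0); split => /=.
    split.
      split => [i|]; first by rewrite mxE invr_ge0.
      under eq_bigr do rewrite mxE.
      by rewrite sumr_const card_ord -[LHS]mulr_natl mulfV// pnatr_eq0 -lt0n.
    by rewrite /= in_itv/= lexx sumr_ge0// => i _; rewrite sumr_ge0.
  by move=> i; rewrite mul0r sumr_ge0// => j _; rewrite mxE mulr_ge0// invr_ge0.
have csnd : {within K, continuous (@snd 'rV[R]_p R)}.
  by apply: continuous_subspaceT => x; exact: cvg_snd.
have [[w s] /set_mem[[[/= w0 w1]]]] := compact_EVT_max K0 cK csnd.
rewrite in_itv/= => /andP[s0 sS] sw smax.
exists w^T, s; split => //.
- by move=> i; rewrite mxE.
- apply/eqP => wT0; have := oner_neq0 R.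
  rewrite -w1 big1 ?eqxx// => i _.
  by have /matrixP/(_ i ord0) := wT0; rewrite !mxE.
- move=> i; rewrite !mxE; apply: le_trans (sw i) _.
  by apply: ler_sum => j _; rewrite mxE.
move=> y t t0 y0 yn0 ty; pose n := \sum_i y i ord0.
have n0 : 0 < n.
  rewrite lt_neqAle (sumr_ge0 _ (fun i _ => y0 i)) andbT eq_sym; apply: contra yn0 => /eqP.
  move=> /(psumr_eq0P (fun i _ => y0 i)) yE.
  by apply/eqP/matrixP => i j; rewrite ord1 mxE yE.
have sy : simplex (n^-1 *: y^T).
  split => [i|]; first by rewrite !mxE mulr_ge0// invr_ge0 ltW.
  under eq_bigr do rewrite !mxE.
  by rewrite -mulr_sumr mulVf// gt_eqF.
have suby : sub (n^-1 *: y^T, t).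
  move=> i /=; rewrite !mxE mulrCA.
  under eq_bigr do rewrite !mxE mulrCA.
  rewrite -mulr_sumr; apply: ler_wpM2l; first by rewrite invr_ge0 ltW.
  by have := ty i; rewrite mxE.
apply: (smax (n^-1 *: y^T, t)); rewrite inE; split => //; split => //=.
by rewrite in_itv/= t0 (bound _ _ sy suby).
Qed.

(** If the maximizer had a nonzero defect [u = A w - s w], then [B u] would be positive in every
    coordinate, and [B w] would admit a value larger than [s]. So [w] is an eigenvector, and [B w] a
    positive one. *)
Lemma perron_right (R : realType) (p : nat) (A : 'M[R]_p) :
  (0 < p)%N -> (forall i j, 0 <= A i j) -> mx_irreducible A ->
  exists (r : 'I_p -> R) (s : R), [/\ 0 <= s, forall i, 0 < r i &
    forall i, \sum_j A i j * r j = s * r i].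
Proof.
move=> p0 A0 irrA; have [B [BA B0]] := mx_irreducible_pos A0 irrA.
have [w [s [s0 w0 wn0 sw smax]]] := perron_maximizer p0 A0.
have y0 := mulmx_pos B0 w0 wn0.
have subE v i : (A *m v - s *: v) i ord0 = (A *m v) i ord0 - s * v i ord0.
  by rewrite [LHS]mxE; congr (_ + _); rewrite !mxE.
pose u := A *m w - s *: w.
have u0 i : 0 <= u i ord0.
  by have := sw i; rewrite subE subr_ge0.
have [u_eq0|un0] := eqVneq u 0.
  exists (fun i => (B *m w) i ord0), s; split => // i.
  have /eqP := u_eq0; rewrite subr_eq0 => /eqP Aw.
  have /matrixP/(_ i ord0) : A *m (B *m w) = s *: (B *m w).
    by rewrite mulmxA -BA -mulmxA Aw scalemxAr.
  by rewrite mxE => ->; rewrite mxE.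
have z0 := mulmx_pos B0 u0 un0.
pose y := B *m w; pose z := B *m u.
have zE : z = A *m y - s *: y by rewrite /z mulmxBr !mulmxA BA scalemxAr.
(* A gain valid in all coordinates at once: [d^-1] exceeds or equals each ratio of [y] to [z]. *)
pose d := (\sum_i y i ord0 / z i ord0)^-1.
have sum_gt0 : 0 < \sum_i y i ord0 / z i ord0.
  rewrite (bigD1 (Ordinal p0))//= ltr_wpDr ?divr_gt0//.
  by rewrite sumr_ge0// => i _; rewrite divr_ge0// ltW.
have d0 : 0 < d by rewrite invr_gt0.
have dz i : d * y i ord0 <= z i ord0.
  rewrite /d mulrC ler_pdivrMr// -ler_pdivrMl// mulrC.
  by rewrite (bigD1 i)//= lerDl sumr_ge0// => j _; rewrite divr_ge0// ltW.
have : s + d <= s.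
  apply: (smax y) => [|i||i]; first by rewrite addr_ge0// ltW.
  - by rewrite ltW// y0.
  - apply/eqP => yE; by have := y0 (Ordinal p0); rewrite -/y yE mxE ltxx.
  - have := dz i; rewrite zE subE.
    by rewrite mulrDl lerBrDl.
by rewrite gerDl leNgt d0.
Qed.

(** * Spectral radius and Perron vectors *)

Lemma normc_sum (R : rcfType) (n : nat) (f : 'I_n -> complex R) :
  ComplexField.Normc.normc (\sum_k f k) <= \sum_k ComplexField.Normc.normc (f k).
Proof.
elim: n f => [|n IH] f.
  by rewrite !big_ord0 ComplexField.Normc.normc0.
rewrite !big_ord_recr; apply: le_trans (le_normcD _ _) _.
by rewrite lerD2r IH.
Qed.

Lemma normc_real (R : rcfType) (x : R) :
  0 <= x -> ComplexField.Normc.normc (real_complex R x) = x.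
Proof. by move=> x0; rewrite /= expr0n addr0 sqrtr_sqr ger0_norm. Qed.

(** Take moduli in the row eigenvector equation [v A = z v], then pair with the positive vector
    [w]. *)
Lemma eigenvalue_le (R : realType) (p : nat) (A : 'M[R]_p) (w : 'I_p -> R)
    (s : R) (z : complex R) :
  (forall i j, 0 <= A i j) -> (forall i, 0 < w i) ->
  (forall i, \sum_j A i j * w j <= s * w i) ->
  eigenvalue (map_mx (real_complex R) A) z -> ComplexField.Normc.normc z <= s.
Proof.
move=> A0 w0 sw /eigenvalueP[v vA vn0].
pose N := @ComplexField.Normc.normc R.
have N0 x : 0 <= N x by case: x => a b; exact: sqrtr_ge0.
have pos : 0 < \sum_j N (v ord0 j) * w j.
  rewrite lt_neqAle sumr_ge0 ?andbT => [|j _]; last by rewrite mulr_ge0// ltW.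
  rewrite eq_sym; apply: contra vn0 => /eqP /psumr_eq0P vE.
  apply/eqP/matrixP => i j; rewrite ord1 mxE.
  have /eqP := vE (fun k _ => mulr_ge0 (N0 _) (ltW (w0 k))) j isT.
  by rewrite mulf_eq0 (gt_eqF (w0 j)) orbF => /eqP/ComplexField.Normc.eq0_normc.
rewrite -(ler_pM2r pos) mulr_sumr.
have step j : N z * N (v ord0 j) <= \sum_i N (v ord0 i) * A i j.
  rewrite -ComplexField.Normc.normcM.
  have /matrixP/(_ ord0 j) := vA; rewrite mxE [RHS]mxE => <-.
  apply: le_trans (normc_sum _) _; apply: ler_sum => i _.
  by rewrite mxE ComplexField.Normc.normcM normc_real.
apply: le_trans (_ : \sum_j (\sum_i N (v ord0 i) * A i j) * w j <= _).
  by apply: ler_sum => j _; rewrite mulrA ler_pM2r.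
under eq_bigr do rewrite mulr_suml.
rewrite exchange_big mulr_sumr; apply: ler_sum => i _ /=.
under eq_bigr do rewrite -mulrA.
by rewrite -mulr_sumr mulrCA ler_wpM2l.
Qed.

(** The row vector [l] makes [s] an eigenvalue, and [w] bounds the modulus of every eigenvalue by
    [s]. *)
Lemma spectral_radius_eigen (R : realType) (p : nat) (A : 'M[R]_p)
    (l w : 'I_p -> R) (s : R) :
  (0 < p)%N -> (forall i j, 0 <= A i j) -> 0 <= s ->
  (forall i, 0 < l i) -> (forall j, \sum_i l i * A i j = s * l j) ->
  (forall i, 0 < w i) -> (forall i, \sum_j A i j * w j = s * w i) ->
  spectral_radius A = s.
Proof.
move=> p0 A0 s0 l0 lA w0 Aw.
have ev : eigenvalue (map_mx (real_complex R) A) (real_complex R s).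
  apply/eigenvalueP; exists (\row_i real_complex R (l i)).
    apply/matrixP => i j; rewrite ord1 !mxE -rmorphM -lA rmorph_sum.
    by apply: eq_bigr => k _; rewrite !mxE rmorphM.
  apply/eqP => /matrixP/(_ ord0 (Ordinal p0)); rewrite !mxE => /eqP.
  by rewrite fmorph_eq0 gt_eqF.
have ub : ubound [set ComplexField.Normc.normc z | z in
    [set z : complex R | eigenvalue (map_mx (real_complex R) A) z]] s.
  move=> _ [z zA <-]; apply: (eigenvalue_le A0 w0) zA => i.
  by rewrite Aw.
have mem : [set ComplexField.Normc.normc z | z in
    [set z : complex R | eigenvalue (map_mx (real_complex R) A) z]] s.
  by exists (real_complex R s) => //; exact: normc_real.
apply/eqP; rewrite eq_le /spectral_radius; apply/andP; split.
  by apply: ge_sup ub; exists s.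
by apply: ub_le_sup mem; exists s.
Qed.

Lemma perron_frobenius (R : realType) (p : nat) (A : 'M[R]_p) :
  (0 < p)%N -> (forall i j, 0 <= A i j) -> mx_irreducible A ->
  exists l r : 'I_p -> R, [/\ forall i, 0 < l i, forall i, 0 < r i,
    forall j, \sum_i l i * A i j = spectral_radius A * l j &
    forall i, \sum_j A i j * r j = spectral_radius A * r i].
Proof.
move=> p0 A0 irrA.
have [r [s [s0 r0 Ar]]] := perron_right p0 A0 irrA.
have AT0 i j : 0 <= A^T i j by rewrite mxE.
have [l [q [_ l0 lA]]] := perron_right p0 AT0 (mx_irreducible_tr irrA).
have {}lA j : \sum_i l i * A i j = q * l j.
  by rewrite -lA; apply: eq_bigr => i _; rewrite mxE mulrC.
have lr0 : 0 < \sum_i l i * r i.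
  by rewrite (bigD1 (Ordinal p0))//= ltr_wpDr ?mulr_gt0// sumr_ge0// => i _;
    rewrite mulr_ge0// ltW.
(* Evaluate [l A r] from the left and from the right, and divide by [l r]. *)
have qs : q = s.
  apply: (mulIf (lt0r_neq0 lr0)); rewrite !mulr_sumr.
  transitivity (\sum_j (\sum_i l i * A i j) * r j).
    by apply: eq_bigr => j _; rewrite lA mulrA.
  under eq_bigr do rewrite mulr_suml.
  rewrite exchange_big; apply: eq_bigr => i _ /=.
  by rewrite mulrCA -Ar mulr_sumr; apply: eq_bigr => j _; rewrite mulrA.
rewrite qs in lA.
by exists l, r; rewrite (spectral_radius_eigen p0 A0 s0 l0 lA r0 Ar).
Qed.

(** Pair the inequality with the positive left Perron vector. This turns any positive test vector
    into an upper bound. *)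
Lemma spectral_radius_le (R : realType) (p : nat) (A : 'M[R]_p) (w : 'I_p -> R)
    (s : R) :
  (0 < p)%N -> (forall i j, 0 <= A i j) -> mx_irreducible A ->
  (forall i, 0 < w i) -> (forall i, \sum_j A i j * w j <= s * w i) ->
  spectral_radius A <= s.
Proof.
move=> p0 A0 irrA w0 Aw.
have [l [_ [l0 _ lA _]]] := perron_frobenius p0 A0 irrA.
have lw0 : 0 < \sum_i l i * w i.
  by rewrite (bigD1 (Ordinal p0))//= ltr_wpDr ?mulr_gt0// sumr_ge0// => i _;
    rewrite mulr_ge0// ltW.
rewrite -(ler_pM2r lw0) !mulr_sumr.
rewrite (_ : \sum_i _ = \sum_i l i * \sum_j A i j * w j).
  by apply: ler_sum => i _; rewrite mulrCA ler_pM2l.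
transitivity (\sum_j (\sum_i l i * A i j) * w j).
  by apply: eq_bigr => j _; rewrite lA mulrA.
under eq_bigr do rewrite mulr_suml.
rewrite exchange_big; apply: eq_bigr => i _ /=.
by rewrite mulr_sumr; apply: eq_bigr => j _; rewrite mulrA.
Qed.

(** Subtract the largest multiple of [l] that leaves [u = v - c l] nonnegative, so that [u] vanishes
    at some [i0]. Then [u A^n] vanishes at [i0] for every [n], and irreducibility spreads the zero
    to all coordinates. *)
Lemma perron_simple (R : realType) (p : nat) (A : 'M[R]_p) (l v : 'I_p -> R)
    (s : R) :
  (0 < p)%N -> (forall i j, 0 <= A i j) -> mx_irreducible A ->
  (forall i, 0 < l i) -> (forall j, \sum_i l i * A i j = s * l j) ->
  (forall j, \sum_i v i * A i j = s * v j) ->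
  exists c : R, forall i, v i = c * l i.
Proof.
move=> p0 A0 irrA l0 lA vA.
have [i0 _ i0min] := @Order.TotalTheory.arg_minP _ _ _ (Ordinal p0) predT
  (fun i => v i / l i) isT.
pose c := v i0 / l i0; exists c; pose u i := v i - c * l i.
have u0 i : 0 <= u i.
  by rewrite subr_ge0 -ler_pdivlMr//; exact: i0min.
have ui0 : u i0 = 0 by rewrite /u /c divfK ?gt_eqF// subrr.
have uAn n j : \sum_i u i * (A ^+ n) i j = s ^+ n * u j.
  elim: n j => [|n IH] j.
    rewrite expr0 mul1r (bigD1 j)//= mxE eqxx mulr1 big1 ?addr0// => i ij.
    by rewrite mxE (negPf ij) mulr0.
  under eq_bigr do rewrite exprSr mxE mulr_sumr.
  rewrite exchange_big /=.
  under eq_bigr do (under eq_bigr do rewrite mulrA; rewrite -mulr_suml IH).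
  under eq_bigr do rewrite -mulrA.
  rewrite -mulr_sumr exprSr -mulrA; congr (_ * _).
  under eq_bigr do rewrite mulrBl -mulrA.
  by rewrite big_split/= sumrN -mulr_sumr lA vA /u; ring.
move=> i; apply/eqP; rewrite -subr_eq0 -/(u i).
have [n An] := irrA i i0.
have := uAn n i0; rewrite ui0 mulr0.
move=> /(psumr_eq0P (fun k _ => mulr_ge0 (u0 k) (exprmx_ge0 n A0 k i0))).
by move=> /(_ i isT) /eqP; rewrite mulf_eq0 (gt_eqF An) orbF.
Qed.

(** Fredholm alternative: solvability is tested against the left kernel of [A - s], which
    [perron_simple] reduces to the multiples of [l]. *)
Lemma perron_solve (R : realType) (p : nat) (A : 'M[R]_p) (l b : 'I_p -> R)
    (s : R) :
  (0 < p)%N -> (forall i j, 0 <= A i j) -> mx_irreducible A ->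
  (forall i, 0 < l i) -> (forall j, \sum_i l i * A i j = s * l j) ->
  \sum_i l i * b i = 0 ->
  exists q : 'I_p -> R, forall i, \sum_j A i j * q j - s * q i = b i.
Proof.
move=> p0 A0 irrA l0 lA lb.
(* Transposed because [submx] compares row spaces; the columns of [cokermx G] are then left
   eigenvectors of [A]. *)
pose G := (A - s%:M)^T.
have scal (f : 'I_p -> R) j : \sum_i f i * (s%:M : 'M[R]_p) i j = s * f j.
  rewrite (bigD1 j)//= mxE eqxx mulr1n mulrC big1 ?addr0// => i ij.
  by rewrite mxE (negPf ij) mulr0n mulr0.
have : (\row_i b i <= G)%MS.
  rewrite submxE; have := mulmx_coker G; move: (cokermx G) => C GC.
  apply/eqP/matrixP => i k; rewrite ord1 !mxE.
  have [|c cE] := @perron_simple _ _ A l (fun j => C j k) s p0 A0 irrA l0 lA.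
    move=> j; apply/eqP; rewrite -subr_eq0 -(scal (fun j => C j k)) -sumrB.
    have /matrixP/(_ j k) := GC; rewrite [RHS]mxE [LHS]mxE => E.
    rewrite -[X in _ == X]E; apply/eqP.
    by apply: eq_bigr => i' _; rewrite !mxE; ring.
  transitivity (c * \sum_i l i * b i); last by rewrite lb mulr0.
  by rewrite mulr_sumr; apply: eq_bigr => j _; rewrite cE mxE; ring.
move=> /submxP[q bE]; exists (fun i => q ord0 i) => i.
have /matrixP/(_ ord0 i) := bE; rewrite !mxE => ->.
transitivity (\sum_j q ord0 j * (A i j - (s%:M : 'M[R]_p) j i)).
  under [RHS]eq_bigr do rewrite mulrBr.
  rewrite big_split/= sumrN scal; congr (_ - _).
  by apply: eq_bigr => j _; rewrite mulrC.
by apply: eq_bigr => j _; rewrite !mxE eq_sym.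
Qed.

(** * Second order expansion of the Perron root *)

Lemma ler_coord_norm (R : realType) (d : nat) (v : 'rV[R]_d) k :
  `|v ord0 k| <= `|v|.
Proof.
rewrite [leRHS]/Num.Def.normr/= mx_normrE.
by apply/bigmax_geP; right => /=; exists (ord0, k).
Qed.

(* The weights l_i A_ij r_j have i-th row sum and i-th column sum both equal to
   s l_i r_i. *)
Lemma perron_drift0 (R : realType) (p : nat) (A : 'M[R]_p) (l r b : 'I_p -> R)
    (s : R) :
  (forall j, \sum_i l i * A i j = s * l j) ->
  (forall i, \sum_j A i j * r j = s * r i) ->
  \sum_i \sum_j l i * A i j * r j * (b j - b i) = 0.
Proof.
move=> lA Ar.
under eq_bigr do (under eq_bigr do rewrite mulrBr; rewrite sumrB).
rewrite sumrB exchange_big /= -sumrB big1// => i _.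
rewrite -!mulr_suml lA.
have -> : \sum_j l i * A i j * r j = l i * \sum_j A i j * r j.
  by rewrite mulr_sumr; apply: eq_bigr => j _; rewrite mulrA.
by rewrite Ar; ring.
Qed.

Lemma sum_mul_gt0 (R : realType) (p : nat) (l r : 'I_p -> R) :
  (0 < p)%N -> (forall i, 0 < l i) -> (forall i, 0 < r i) ->
  0 < \sum_i l i * r i.
Proof.
move=> p0 l0 r0; rewrite (bigD1 (Ordinal p0))//= ltr_wpDr ?mulr_gt0//.
by rewrite sumr_ge0// => i _; rewrite mulr_ge0// ltW.
Qed.

(** Average the entrywise inequality with weights [l i * r j], taking for [kappa] a difference
    [b j - b i]. The [kappa] terms cancel by [perron_drift0]. *)
Lemma spectral_radius_ge_tangent (R : realType) (p : nat) (A B D : 'M[R]_p)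
    (l r : 'I_p -> R)
    (s : R) :
  (0 < p)%N -> (forall i j, 0 <= B i j) -> mx_irreducible B ->
  (forall i, 0 < l i) -> (forall i, 0 < r i) ->
  (forall j, \sum_i l i * A i j = s * l j) ->
  (forall i, \sum_j A i j * r j = s * r i) ->
  (forall i j kappa, A i j * (1 + kappa) + D i j <= B i j * expR kappa) ->
  s + (\sum_i \sum_j l i * D i j * r j) / (\sum_i l i * r i) <=
  spectral_radius B.
Proof.
move=> p0 B0 irrB l0 r0 lA Ar AB.
have [_ [w [_ w0 _ Bw]]] := perron_frobenius p0 B0 irrB.
move: (spectral_radius B) Bw => sB Bw; have lr0 := sum_mul_gt0 p0 l0 r0.
rewrite -(ler_pM2r lr0) mulrDl divfK ?gt_eqF//.
(* This tilt turns [r j * B i j * expR (b j - b i)] into [r i / w i] times the terms of [B w], which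
   sum to [sB * w i]. *)
pose b i := ln (w i / r i).
have expb i j : expR (b j - b i) = (w j / r j) / (w i / r i).
  by rewrite expRD expRN !lnK// posrE divr_gt0.
have -> : s * (\sum_i l i * r i) =
    \sum_i \sum_j l i * A i j * r j * (1 + (b j - b i)).
  under [RHS]eq_bigr => i _.
    under eq_bigr => j _ do rewrite mulrDr mulr1.
    rewrite big_split; over.
  rewrite big_split /= (perron_drift0 b lA Ar) addr0 mulr_sumr.
  apply: eq_bigr => i _; rewrite mulrCA -Ar mulr_sumr.
  by apply: eq_bigr => j _; rewrite mulrA.
rewrite -big_split mulr_sumr /=; apply: ler_sum => i _.
rewrite -big_split /=.
have -> : sB * (l i * r i) =
    \sum_j l i * r j * (B i j * expR (b j - b i)).
  transitivity (l i * r i / w i * (sB * w i)).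
    by field; rewrite gt_eqF.
  rewrite -Bw mulr_sumr; apply: eq_bigr => j _.
  by rewrite expb; field; rewrite !gt_eqF.
apply: ler_sum => j _.
have /(ler_wpM2l (ltW (mulr_gt0 (l0 i) (r0 j)))) := AB i j (b j - b i).
by apply: le_trans; rewrite le_eqVlt; apply/orP; left; apply/eqP; ring.
Qed.

(** The two last hypotheses are entrywise bounds, jointly in the displacement [v] and a tilt
    [kappa]; the tilt absorbs the variation of the Perron vector. *)
Lemma spectral_radius_expansion (R : realType) (d p : nat)
    (M : 'rV[R]_d -> 'M[R]_p) (D : 'I_d -> 'M[R]_p) (t : 'rV[R]_d) :
  (0 < p)%N -> (forall y i j, 0 <= M y i j) -> (forall y, mx_irreducible (M y)) ->
  (forall (v : 'rV[R]_d) kappa i j, M t i j * (1 + kappa) + \sum_k v ord0 k * D k i j <=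
     M (t + v) i j * expR kappa) ->
  (forall K, exists C, forall (v : 'rV[R]_d) kappa i j,
     `|v| <= 1 -> `|kappa| <= K * `|v| ->
     M (t + v) i j * expR kappa <=
     M t i j * (1 + kappa) + \sum_k v ord0 k * D k i j + C * `|v| ^+ 2) ->
  exists (g : 'rV[R]_d) (C : R), forall v : 'rV[R]_d,
    spectral_radius (M t) + dotv g v <= spectral_radius (M (t + v)) /\
    (`|v| <= 1 ->
     spectral_radius (M (t + v)) <=
     spectral_radius (M t) + dotv g v + C * `|v| ^+ 2).
Proof.
move=> p0 M0 irrM lowM upM.
have [l [r [l0 r0 lA Ar]]] := perron_frobenius p0 (M0 t) (irrM t).
have lr0 := sum_mul_gt0 p0 l0 r0.
(* The first order perturbation formula for a simple eigenvalue. *)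
pose g := \row_k ((\sum_i \sum_j l i * D k i j * r j) / (\sum_i l i * r i)).
(* [q k] is the first order variation of the right Perron vector along coordinate [k]. The choice of
   [g] makes the right-hand side orthogonal to [l]. *)
have /choice[q qE] (k : 'I_d) : exists q : 'I_p -> R, forall i,
    \sum_j M t i j * q j - spectral_radius (M t) * q i =
    g ord0 k * r i - \sum_j D k i j * r j.
  apply: (perron_solve p0 (M0 t) (irrM t) l0 lA).
  under eq_bigr do rewrite mulrBr mulrCA.
  rewrite sumrB -mulr_sumr mxE divfK ?gt_eqF//; apply/eqP; rewrite subr_eq0.
  apply/eqP; apply: eq_bigr => i _; rewrite mulr_sumr.
  by apply: eq_bigr => j _; rewrite mulrA.
pose S := \sum_k \sum_j `|q k j / r j|.
pose eta (v : 'rV[R]_d) j := \sum_k v ord0 k * (q k j / r j).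
have eta_le v j : `|eta v j| <= S * `|v|.
  rewrite mulrC mulr_sumr; apply: le_trans (ler_norm_sum _ _ _) _.
  apply: ler_sum => k _; rewrite normrM ler_pM ?ler_coord_norm//.
  by rewrite (bigD1 j)//= lerDl sumr_ge0.
have [C upC] := upM (2 * S).
(* The error in row [i] is at most [C * sr * |v|^2] and must be compared with [r i]; the sum of
   inverses dominates each [(r i)^-1]. *)
pose sr := \sum_j r j; pose C' := `|C| * sr * \sum_i (r i)^-1.
have sr0 : 0 <= sr by rewrite sumr_ge0// => j _; rewrite ltW.
exists g, C' => v; split.
  have := spectral_radius_ge_tangent p0 (M0 (t + v)) (irrM (t + v)) l0 r0 lA Ar
    (D := \matrix_(i, j) \sum_k v ord0 k * D k i j) (fun i j kappa => _).
  set X := _ / _; have -> : X = dotv g v.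
    rewrite /X /dotv mulr_suml.
    under [RHS]eq_bigr do rewrite mxE mulrAC mulr_suml mulr_suml.
    rewrite exchange_big /=; apply: eq_bigr => i _.
    under [RHS]eq_bigr do rewrite mulr_suml mulr_suml.
    rewrite exchange_big /= mulr_suml; apply: eq_bigr => j _.
    rewrite mxE mulr_sumr !mulr_suml; apply: eq_bigr => k _; ring.
  by apply => i j kappa; rewrite mxE.
move=> v1; apply: (@spectral_radius_le _ _ _ (fun j => r j * expR (eta v j))) => //.
  by move=> i; rewrite mulr_gt0// expR_gt0.
move=> i.
have etaB j : `|eta v j - eta v i| <= 2 * S * `|v|.
  apply: le_trans (ler_normB _ _) _.
  by have := eta_le v j; have := eta_le v i; lra.
apply: le_trans (_ : \sum_j expR (eta v i) * (r j * (M t i j *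
   (1 + (eta v j - eta v i)) + \sum_k v ord0 k * D k i j + C * `|v| ^+ 2)) <= _).
  apply: ler_sum => j _.
  have U := upC v _ i j v1 (etaB j).
  have := ler_wpM2l (mulr_ge0 (ltW (expR_gt0 (eta v i))) (ltW (r0 j))) U.
  rewrite -[X in _ <= X]mulrA; apply: le_trans.
  rewrite expRD expRN le_eqVlt; apply/orP; left.
  by apply/eqP; field; rewrite gt_eqF ?expR_gt0.
rewrite -mulr_sumr [leRHS]mulrC -[leRHS]mulrA [leRHS]mulrCA.
rewrite ler_pM2l ?expR_gt0//.
have -> : \sum_j r j * (M t i j * (1 + (eta v j - eta v i)) +
    \sum_k v ord0 k * D k i j + C * `|v| ^+ 2) =
    r i * (spectral_radius (M t) + dotv g v) + C * sr * `|v| ^+ 2.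
  transitivity (\sum_j M t i j * r j + (\sum_j M t i j * (r j * eta v j)
      - eta v i * \sum_j M t i j * r j) + \sum_k v ord0 k * \sum_j D k i j * r j
      + C * sr * `|v| ^+ 2).
    have -> : \sum_k v ord0 k * (\sum_j D k i j * r j) =
        \sum_j r j * \sum_k v ord0 k * D k i j.
      under eq_bigr do rewrite mulr_sumr.
      rewrite exchange_big; apply: eq_bigr => j _ /=; rewrite mulr_sumr.
      by apply: eq_bigr => k _; ring.
    rewrite [C * sr]mulrC -(mulrA sr) [eta v i * _]mulr_sumr /sr mulr_suml -sumrB -!big_split /=.
    by apply: eq_bigr => j _; ring.
  (* The first order terms: the equation [qE] trades the variation of the eigenvector plus [D k]
     applied to [r] for [g ord0 k * r i]. *)
  congr (_ + _).
  have -> : \sum_j M t i j * (r j * eta v j) =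
      \sum_k v ord0 k * \sum_j M t i j * q k j.
    under [RHS]eq_bigr do rewrite mulr_sumr.
    rewrite exchange_big; apply: eq_bigr => j _ /=; rewrite /eta !mulr_sumr.
    by apply: eq_bigr => k _; field; rewrite gt_eqF.
  rewrite Ar /eta mulr_suml -addrA -[in X in _ + (X + _)]sumrB -big_split /=.
  rewrite mulrDr mulrC; congr (_ + _); rewrite /dotv mulr_sumr.
  apply: eq_bigr => k _.
  have E := qE k i.
  have -> : \sum_j M t i j * q k j = g ord0 k * r i - \sum_j D k i j * r j +
    spectral_radius (M t) * q k i by rewrite -E; ring.
  by field; rewrite gt_eqF.
rewrite [leRHS]mulrDr lerD2l [leRHS]mulrA ler_wpM2r ?sqr_ge0//.
apply: le_trans (_ : `|C| * sr <= _); first by rewrite ler_wpM2r// ler_norm.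
rewrite /C' mulrCA ler_peMr ?mulr_ge0//.
rewrite mulr_sumr (bigD1 i)//= mulfV ?gt_eqF// lerDl sumr_ge0// => j _.
by rewrite mulr_ge0// ?invr_ge0 ltW.
Qed.

(** * Exponential sums *)

(** From [1 - b <= expR (- b)] comes [expR b <= 1 + b * expR b]. Insert this bound into itself if
    [b >= 0]; otherwise use [expR b >= 1 + b], which multiplication by [b] reverses. *)
Lemma expR_le_quad (R : realType) (b : R) :
  expR b <= 1 + b + b ^+ 2 * expR `|b|.
Proof.
have eb : expR b <= 1 + b * expR b.
  have := ler_wpM2r (expR_ge0 b) (expR_ge1Dx (- b)).
  by rewrite [leRHS]mulrC expRxMexpNx_1; lra.
have [b0|b0] := leP 0 b.
  by rewrite ger0_norm//; have := ler_wpM2l b0 eb; nra.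
apply: le_trans eb _; rewrite -addrA lerD2l.
have b1 := expR_ge1Dx b; have := expR_ge1Dx `|b|; have := normr_ge0 b.
by nra.
Qed.

Lemma sqr_le_expR (R : realType) (a : R) : 0 <= a -> a ^+ 2 <= 4 * expR a.
Proof.
move=> a0; have -> : a = a / 2 + a / 2 by field.
by rewrite expRD; have := expR_ge1Dx (a / 2); nra.
Qed.

(** The norm dual to the sup norm of row vectors. *)
Definition l1norm (R : realType) (d : nat) (v : 'rV[R]_d) : R :=
  \sum_k `|v ord0 k|.

Lemma l1norm_ge0 (R : realType) (d : nat) (v : 'rV[R]_d) : 0 <= l1norm v.
Proof. by rewrite sumr_ge0. Qed.

Lemma ler_norm_dotv (R : realType) (d : nat) (u v : 'rV[R]_d) :
  `|dotv u v| <= `|u| * l1norm v.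
Proof.
rewrite mulr_sumr; apply: le_trans (ler_norm_sum _ _ _) _.
by apply: ler_sum => k _; rewrite normrM ler_wpM2r// ler_coord_norm.
Qed.

Definition exp_moments (R : realType) (T : choiceType) (d : nat)
    (X : T -> 'rV[R]_d) (m : T -> R) : Prop :=
  forall gamma : R, 0 < gamma ->
    rsummable (fun x => expR (gamma * l1norm (X x)) * m x).

Lemma exp_moments_summable (R : realType) (T : choiceType) (d : nat)
    (X : T -> 'rV[R]_d) (m : T -> R) (C gamma : R) (h : T -> R) :
  (forall x, 0 <= m x) -> exp_moments X m -> 0 < gamma ->
  (forall x, `|h x| <= C * expR (gamma * l1norm (X x))) ->
  rsummable (fun x => h x * m x).
Proof.
move=> m0 mX g0 hX; apply: (rsummable_le _ (rsummableZ C (mX gamma g0))) => x.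
by rewrite normrM (ger0_norm (m0 x)) mulrA ler_wpM2r.
Qed.

Definition laplace (R : realType) (T : choiceType) (d : nat)
    (X : T -> 'rV[R]_d) (m : T -> R) (t : 'rV[R]_d) : R :=
  rsum (fun x => expR (dotv t (X x)) * m x).

(** Partial derivative of [laplace], by formal differentiation under the sum. *)
Definition laplace_deriv (R : realType) (T : choiceType) (d : nat)
    (X : T -> 'rV[R]_d) (m : T -> R) (t : 'rV[R]_d) (k : 'I_d) : R :=
  rsum (fun x => X x ord0 k * expR (dotv t (X x)) * m x).

Lemma expR_dotv_le (R : realType) (d : nat) (t v : 'rV[R]_d) :
  expR (dotv t v) <= expR (`|t| * l1norm v).
Proof. by rewrite ler_expR (le_trans (ler_norm _))// ler_norm_dotv. Qed.

Lemma laplace_summable (R : realType) (T : choiceType) (d : nat)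
    (X : T -> 'rV[R]_d) (m : T -> R) (t : 'rV[R]_d) :
  (forall x, 0 <= m x) -> exp_moments X m ->
  rsummable (fun x => expR (dotv t (X x)) * m x).
Proof.
(* The added 1 keeps the exponent positive when [t = 0]. *)
move=> m0 mX; apply: (exp_moments_summable (C := 1) (gamma := `|t| + 1) m0 mX) => //.
move=> x; rewrite mul1r ger0_norm ?expR_ge0// (le_trans (expR_dotv_le _ _))//.
by rewrite ler_expR ler_wpM2r ?l1norm_ge0// lerDl.
Qed.

Lemma laplace_deriv_summable (R : realType) (T : choiceType) (d : nat)
    (X : T -> 'rV[R]_d) (m : T -> R) (t : 'rV[R]_d) (k : 'I_d) :
  (forall x, 0 <= m x) -> exp_moments X m ->
  rsummable (fun x => X x ord0 k * expR (dotv t (X x)) * m x).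
Proof.
(* The added 1 in the exponent absorbs the linear factor, each coordinate being at most [expR] of
   the l1 norm. *)
move=> m0 mX; apply: (exp_moments_summable (C := 1) (gamma := 1 + `|t|) m0 mX) => //.
move=> x; rewrite mul1r normrM (ger0_norm (expR_ge0 _)) mulrDl mul1r expRD.
rewrite ler_pM ?expR_ge0 ?expR_dotv_le//.
apply: le_trans (_ : l1norm (X x) <= _).
  by rewrite /l1norm (bigD1 k)//= lerDl sumr_ge0.
by have := expR_ge1Dx (l1norm (X x)); lra.
Qed.

Lemma dotv_sum_deriv (R : realType) (T : choiceType) (d : nat)
    (X : T -> 'rV[R]_d) (m : T -> R) (t v : 'rV[R]_d) :
  (forall x, 0 <= m x) -> exp_moments X m ->
  rsummable (fun x => dotv v (X x) * (expR (dotv t (X x)) * m x)) /\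
  \sum_k v ord0 k * laplace_deriv X m t k =
  rsum (fun x => dotv v (X x) * (expR (dotv t (X x)) * m x)).
Proof.
move=> m0 mX.
have E : (fun x => dotv v (X x) * (expR (dotv t (X x)) * m x)) =
    fun x => \sum_k v ord0 k * (X x ord0 k * expR (dotv t (X x)) * m x).
  by apply/funext => x; rewrite /dotv mulr_suml; apply: eq_bigr => k _; ring.
have sk k : rsummable (fun x => X x ord0 k * expR (dotv t (X x)) * m x).
  exact: laplace_deriv_summable.
split; rewrite E.
  by apply: rsummable_sum => k; exact: rsummableZ.
rewrite rsum_sum => [|k]; last exact: rsummableZ.
by apply: eq_bigr => k _; rewrite rsumZ.
Qed.

Lemma dotvDl (R : realType) (d : nat) (u v w : 'rV[R]_d) :
  dotv (u + v) w = dotv u w + dotv v w.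
Proof. by rewrite -big_split; apply: eq_bigr => k _; rewrite mxE mulrDl. Qed.

(** The inequality [1 + s <= expR s] at [s = kappa + dotv v (X x)], summed with weights
    [expR (dotv t (X x)) * m x]. *)
Lemma laplace_tangent (R : realType) (T : choiceType) (d : nat)
    (X : T -> 'rV[R]_d) (m : T -> R) (t v : 'rV[R]_d) (kappa : R) :
  (forall x, 0 <= m x) -> exp_moments X m ->
  laplace X m t * (1 + kappa) + \sum_k v ord0 k * laplace_deriv X m t k <=
  laplace X m (t + v) * expR kappa.
Proof.
move=> m0 mX; have [sv ->] := dotv_sum_deriv t v m0 mX.
have st y := laplace_summable y m0 mX.
rewrite mulrC [leRHS]mulrC -!rsumZ// -rsumD//; last exact: rsummableZ.
apply: le_rsum.
- by apply: rsummableD => //; exact: rsummableZ.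
- exact: rsummableZ.
move=> x; rewrite -mulrDl !mulrA ler_wpM2r// dotvDl -expRD addrCA expRD mulrC.
by rewrite ler_wpM2l ?expR_ge0// -addrA expR_ge1Dx.
Qed.

(** Apply [expR_le_quad] termwise at [kappa + b], whose modulus is at most [|v| * a] with
    [a = |K| + N]. The error is then at most [|v|^2 * a^2 * expR a], and [a^2 <= 4 * expR a] makes
    it summable uniformly in [v] and [kappa]. *)
Lemma laplace_upper (R : realType) (T : choiceType) (d : nat)
    (X : T -> 'rV[R]_d) (m : T -> R) (t : 'rV[R]_d) (K : R) :
  (forall x, 0 <= m x) -> exp_moments X m ->
  exists C, forall (v : 'rV[R]_d) (kappa : R),
    `|v| <= 1 -> `|kappa| <= K * `|v| ->
    laplace X m (t + v) * expR kappa <=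
    laplace X m t * (1 + kappa) + \sum_k v ord0 k * laplace_deriv X m t k +
    C * `|v| ^+ 2.
Proof.
move=> m0 mX.
have st y := laplace_summable y m0 mX.
pose h x := 4 * expR (2 * (`|K| + l1norm (X x))) * expR (dotv t (X x)).
have sh : rsummable (fun x => h x * m x).
  apply: (exp_moments_summable (C := 4 * expR (2 * `|K|)) (gamma := 2 + `|t|) m0 mX) => //.
  move=> x; rewrite ger0_norm ?mulr_ge0 ?expR_ge0// /h.
  by rewrite (mulrDr 2) (mulrDl 2) !expRD !mulrA ler_wpM2l ?expR_dotv_le//.
exists (rsum (fun x => h x * m x)) => v kappa v1 kv.
have [sv ->] := dotv_sum_deriv t v m0 mX.
rewrite [_ * expR _]mulrC [_ * (1 + _)]mulrC [_ * `|v| ^+ 2]mulrC /laplace -!rsumZ//.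
have s1 := rsummableZ (1 + kappa) (st t).
have s12 := rsummableD s1 sv; have s3 := rsummableZ (`|v| ^+ 2) sh.
rewrite -(rsumD s1 sv) -(rsumD s12 s3).
apply: le_rsum; [exact: rsummableZ|exact: rsummableD|].
move=> x; rewrite !mulrA -!mulrDl ler_wpM2r// dotvDl expRD /h.
set E := expR (dotv t (X x)); have E0 : 0 < E by exact: expR_gt0.
set b := dotv v (X x); set N := l1norm (X x).
suff : expR kappa * expR b <=
    1 + kappa + b + `|v| ^+ 2 * (4 * expR (2 * (`|K| + N))).
  by move=> /(ler_wpM2l (ltW E0)) H; apply: le_trans (le_trans H _); 
    rewrite le_eqVlt; apply/orP; left; apply/eqP; ring.
rewrite -expRD -(addrA 1); apply: le_trans (expR_le_quad _) _; rewrite lerD2l.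
have a0 : 0 <= `|K| + N by rewrite addr_ge0// l1norm_ge0.
have bN : `|kappa + b| <= `|v| * (`|K| + N).
  apply: le_trans (ler_normD _ _) _; rewrite mulrDr lerD ?ler_norm_dotv//.
  by apply: le_trans kv _; rewrite mulrC ler_wpM2l// ler_norm.
have ba : `|kappa + b| <= `|K| + N by apply: le_trans bN _; exact: ler_piMl.
have -> : 2 * (`|K| + N) = (`|K| + N) + (`|K| + N) by ring.
rewrite expRD !mulrA ler_pM ?sqr_ge0 ?expR_ge0 ?ler_expR//.
rewrite -mulrA -real_normK ?num_real//.
apply: le_trans (_ : `|v| ^+ 2 * (`|K| + N) ^+ 2 <= _).
  by rewrite -exprMn lerXn2r ?nnegrE ?mulr_ge0.
by rewrite ler_wpM2l ?sqr_ge0// sqr_le_expR.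
Qed.

(** * The killed random walk *)

Lemma mu_ge0 (R : realType) (d p : nat)
    (c : 'rV[int]_d -> 'I_p -> 'I_p -> R) (m : 'I_p -> R) i j x :
  (forall x i j, 0 <= c x i j) -> (forall i, 1 <= m i) -> 0 <= mu c m i j x.
Proof.
move=> c0 m1; rewrite divr_ge0// mulr_ge0 ?fine_ge0// ?(le_trans ler01)//.
by rewrite esum_ge0// => yj _; rewrite lee_fin.
Qed.

Lemma krw_step_ge0 (R : realType) (d p : nat)
    (c : 'rV[int]_d -> 'I_p -> 'I_p -> R) (m : 'I_p -> R) a b :
  (forall x i j, 0 <= c x i j) -> (forall i, 1 <= m i) -> 0 <= krw_step c m a b.
Proof.
move=> c0 m1; case: a b => [[x i]|] [[y j]|] //=; first exact: mu_ge0.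
by rewrite subr_ge0 invf_le1// (lt_le_trans ltr01).
Qed.

Lemma krw_prob_ge0 (R : realType) (d p : nat)
    (c : 'rV[int]_d -> 'I_p -> 'I_p -> R) (m : 'I_p -> R) n a b :
  (forall x i j, 0 <= c x i j) -> (forall i, 1 <= m i) ->
  (0 <= krw_prob c m n a b)%E.
Proof.
move=> c0 m1; elim: n a => [|n IH] a /=; first by rewrite lee_fin ler0n.
by apply: esum_ge0 => s _; rewrite mule_ge0// lee_fin krw_step_ge0.
Qed.

Lemma krw_prob_killed (R : realType) (d p : nat)
    (c : 'rV[int]_d -> 'I_p -> 'I_p -> R) (m : 'I_p -> R) n y :
  krw_prob c m n None (Some y) = 0%E.
Proof.
elim: n => [//|n IH] /=; apply: esum1 => -[s|] _; first by rewrite mul0e.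
by rewrite IH mule0.
Qed.

Lemma esum_gt0_ex (R : realType) (T : choiceType) (f : T -> \bar R) :
  (forall x, 0 <= f x)%E -> (0 < \esum_(x in setT) f x)%E ->
  exists x, (0 < f x)%E.
Proof.
move=> f0 sf; apply: contrapT => nf.
move: sf; rewrite esum1 ?ltxx// => x _.
apply/eqP; rewrite eq_le f0 andbT leNgt; apply/negP => fx.
by apply: nf; exists x.
Qed.

Lemma rsum_ge_term (R : realType) (T : choiceType) (f : T -> R) x :
  rsummable f -> (forall y, 0 <= f y) -> f x <= rsum f.
Proof.
move=> sf f0; rewrite rsum_ge0E// -lee_fin fineK ?esum_fin_num//.
apply: esum_ge; exists [set x]; first by split; [exact: finite_set1|].
by rewrite fsbig_set1.
Qed.

Lemma coord_le_enorm (R : realType) (d : nat) (v : 'rV[R]_d) k :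
  `|v ord0 k| <= enorm v.
Proof.
rewrite -sqrtr_sqr ler_wsqrtr// /dotv (bigD1 k)//= -expr2 lerDl.
by rewrite sumr_ge0// => j _; rewrite -expr2 sqr_ge0.
Qed.

Lemma zvecD (R : realType) (d : nat) (x y : 'rV[int]_d) :
  zvec R (x + y) = zvec R x + zvec R y.
Proof. by apply/matrixP => i j; rewrite !mxE intrD. Qed.

Lemma dotvDr (R : realType) (d : nat) (u v w : 'rV[R]_d) :
  dotv u (v + w) = dotv u v + dotv u w.
Proof. by rewrite -big_split; apply: eq_bigr => k _; rewrite mxE mulrDr. Qed.

Lemma mu_exp_moments (R : realType) (d p : nat)
    (c : 'rV[int]_d -> 'I_p -> 'I_p -> R) (m : 'I_p -> R) i j :
  (0 < d)%N -> (forall x i j, 0 <= c x i j) -> (forall i, 1 <= m i) ->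
  assumption_A c m -> exp_moments (@zvec R d) (mu c m i j).
Proof.
move=> d0 c0 m1 hA gamma g0.
have mu0 x := mu_ge0 i j x c0 m1.
(* The l1 norm is at most [d] times the Euclidean norm of the moment assumption. *)
have gd0 : 0 < gamma * d%:R by rewrite mulr_gt0// ltr0n.
have ge0 (a : R) x : 0 <= expR a * mu c m i j x by rewrite mulr_ge0 ?expR_ge0.
apply: (rsummable_le _ ((rsummable_ge0 (fun x => ge0 _ x)).2
  (A_exp_moments hA i j gd0))) => x.
rewrite ger0_norm//= ler_wpM2r// ler_expR -mulrA (ler_wpM2l (ltW g0))//.
have -> : d%:R * enorm (zvec R x) = \sum_(k < d) enorm (zvec R x).
  by rewrite sumr_const card_ord mulr_natl.
by apply: ler_sum => k _; exact: coord_le_enorm.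
Qed.

Lemma LmuE (R : realType) (d p : nat)
    (c : 'rV[int]_d -> 'I_p -> 'I_p -> R) (m : 'I_p -> R) t i j :
  (0 < d)%N -> (forall x i j, 0 <= c x i j) -> (forall i, 1 <= m i) ->
  assumption_A c m ->
  Lmu c m t i j = laplace (@zvec R d) (mu c m i j) t.
Proof.
move=> d0 c0 m1 hA; have mu0 x := mu_ge0 i j x c0 m1.
rewrite mxE /laplace rsum_ge0E//.
  exact: (laplace_summable _ mu0 (mu_exp_moments _ _ d0 c0 m1 hA)).
by move=> x; rewrite mulr_ge0// expR_ge0.
Qed.

Lemma Lmu_ge_term (R : realType) (d p : nat)
    (c : 'rV[int]_d -> 'I_p -> 'I_p -> R) (m : 'I_p -> R) t i j x :
  (0 < d)%N -> (forall x i j, 0 <= c x i j) -> (forall i, 1 <= m i) ->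
  assumption_A c m ->
  expR (dotv t (zvec R x)) * mu c m i j x <= Lmu c m t i j.
Proof.
move=> d0 c0 m1 hA; have mu0 x' := mu_ge0 i j x' c0 m1.
rewrite LmuE//.
apply: (@rsum_ge_term R 'rV[int]_d
  (fun x => expR (dotv t (zvec R x)) * mu c m i j x)).
  exact: (laplace_summable _ mu0 (mu_exp_moments _ _ d0 c0 m1 hA)).
by move=> y; rewrite mulr_ge0// expR_ge0.
Qed.

Lemma Lmu_ge0 (R : realType) (d p : nat)
    (c : 'rV[int]_d -> 'I_p -> 'I_p -> R) (m : 'I_p -> R) t i j :
  (forall x i j, 0 <= c x i j) -> (forall i, 1 <= m i) -> 0 <= Lmu c m t i j.
Proof.
move=> c0 m1; rewrite mxE fine_ge0// esum_ge0// => x _.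
by rewrite lee_fin mulr_ge0 ?expR_ge0 ?mu_ge0.
Qed.

(** Follow one path of positive probability: the exponential weights of its steps multiply to that
    of the total displacement, and [kappa], the product of its [mu] factors, is the same for all
    [t]. *)
Lemma Lmu_pow_ge (R : realType) (d p : nat)
    (c : 'rV[int]_d -> 'I_p -> 'I_p -> R) (m : 'I_p -> R) n x i y j :
  (0 < d)%N -> (forall x i j, 0 <= c x i j) -> (forall i, 1 <= m i) ->
  assumption_A c m ->
  (0 < krw_prob c m n (Some (x, i)) (Some (y, j)))%E ->
  exists2 kappa : R, 0 < kappa & forall t : 'rV[R]_d,
    kappa * expR (dotv t (zvec R (y - x))) <= (Lmu c m t ^+ n) i j.
Proof.
move=> d0 c0 m1 hA; elim: n x i => [|n IH] x i /=.
  rewrite lte_fin ltr0n lt0b => /eqP[-> ->]; exists 1 => // t.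
  rewrite mul1r expr0 mxE eqxx subrr.
  suff -> : dotv t (zvec R 0) = 0 by rewrite expR0.
  by rewrite /dotv big1// => k _; rewrite !mxE mulr0.
have step_ge0 s : (0 <= (krw_step c m (Some (x, i)) s)%:E *
    krw_prob c m n s (Some (y, j)))%E.
  by rewrite mule_ge0 ?krw_prob_ge0// lee_fin krw_step_ge0.
move=> /(esum_gt0_ex step_ge0)[[[z k]|]]; last first.
  by rewrite krw_prob_killed mule0 ltxx.
move=> step0.
have mu0 : 0 < mu c m i k (z - x).
  rewrite lt_neqAle mu_ge0// andbT eq_sym; apply/eqP => mu0.
  by move: step0; rewrite /= mu0 mul0e ltxx.
have /IH[kappa kappa0 kappaP] : (0 < krw_prob c m n (Some (z, k)) (Some (y, j)))%E.
  rewrite lt_neqAle krw_prob_ge0// andbT eq_sym; apply/eqP => P0.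
  by move: step0; rewrite P0 mule0 ltxx.
exists (mu c m i k (z - x) * kappa) => [|t]; first exact: mulr_gt0.
have -> : y - x = (z - x) + (y - z) by rewrite [RHS]addrC addrA subrK.
rewrite zvecD dotvDr expRD exprS [leRHS]mxE (bigD1 k)//= -[leLHS]addr0.
apply: lerD; last first.
  rewrite sumr_ge0// => l _; rewrite mulr_ge0 ?Lmu_ge0//.
  by apply: exprmx_ge0 => *; exact: Lmu_ge0.
rewrite mulrACA; apply: ler_pM; [| |by rewrite mulrC; exact: Lmu_ge_term|by []].
- exact: mulr_ge0 (ltW mu0) (expR_ge0 _).
- exact: mulr_ge0 (ltW kappa0) (expR_ge0 _).
Qed.

Lemma Lmu_irreducible (R : realType) (d p : nat)
    (c : 'rV[int]_d -> 'I_p -> 'I_p -> R) (m : 'I_p -> R) t :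
  (0 < d)%N -> (forall x i j, 0 <= c x i j) -> (forall i, 1 <= m i) ->
  assumption_A c m -> mx_irreducible (Lmu c m t).
Proof.
move=> d0 c0 m1 hA i j; have [n [_ Pn]] := A_irreducible hA i j 0.
have [kappa k0 /(_ t) kP] := Lmu_pow_ge d0 c0 m1 hA Pn.
by exists n; apply: lt_le_trans kP; rewrite mulr_gt0 ?expR_gt0.
Qed.

Lemma esum_setT_fin (R : realType) (I : finType) (f : I -> \bar R) :
  (forall i, 0 <= f i)%E -> (\esum_(i in setT) f i = \sum_i f i)%E.
Proof.
move=> f0; rewrite fsbig_seq ?index_enum_uniq//.
rewrite -esum_fset; [|exact: finite_seq|by []].
by congr esum; apply/seteqP; split => // x _ /=; rewrite mem_index_enum.
Qed.

(** At [t = 0] a row sum is the probability of surviving one step: [sigma c i] splits over the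
    arrival type [j] and cancels. *)
Lemma sum_Lmu0 (R : realType) (d p : nat)
    (c : 'rV[int]_d -> 'I_p -> 'I_p -> R) (m : 'I_p -> R) i :
  (0 < d)%N -> (forall x i j, 0 <= c x i j) -> (forall i, 1 <= m i) ->
  (forall i, 0 < sigma c i /\ sigma c i < +oo)%E -> assumption_A c m ->
  \sum_j Lmu c m 0 i j = (m i)^-1.
Proof.
move=> d0 c0 m1 sc hA; have [s0 soo] := sc i.
have sE : (sigma c i = \sum_j \esum_(x in setT) (c x i j)%:E)%E.
  rewrite -esum_sum//=; last by move=> x j _ _; rewrite lee_fin.
  rewrite /sigma.
  have -> : [set: 'rV[int]_d * 'I_p] = [set: 'rV[int]_d] `*`` (fun=> [set: 'I_p]).
    by apply/seteqP; split.
  rewrite -(@esum_esum _ _ _ _ _ (fun x j => (c x i j)%:E)); last first.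
    by move=> *; rewrite lee_fin.
  by apply: eq_esum => x _; rewrite esum_setT_fin// => j; rewrite lee_fin.
have sc_j j : rsummable (fun x => c x i j).
  apply/rsummable_ge0 => //; apply: le_lt_trans soo.
  rewrite sE (bigD1 j)//= leeDl// sume_ge0// => k _.
  by rewrite esum_ge0// => x _; rewrite lee_fin.
have sig0 : 0 < fine (sigma c i) by rewrite fine_gt0// s0.
have mi0 : 0 < m i by rewrite (lt_le_trans ltr01).
have dot0 x : dotv 0 (zvec R x) = 0 :> R.
  by rewrite /dotv big1// => k _; rewrite mxE mul0r.
transitivity (\sum_j (m i * fine (sigma c i))^-1 * rsum (fun x => c x i j)).
  apply: eq_bigr => j _; rewrite LmuE// -rsumZ//; congr rsum; apply/funext => x.
  by rewrite dot0 expR0 mul1r mulrC.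
rewrite -mulr_sumr.
have -> : \sum_j rsum (fun x => c x i j) = fine (sigma c i).
  apply: EFin_inj; rewrite fineK; last by rewrite ge0_fin_numE// ltW.
  rewrite sE -sumEFin; apply: eq_bigr => j _.
  by rewrite rsum_ge0E// fineK// esum_fin_num.
by rewrite invfM -mulrA mulVf ?mulr1// gt_eqF.
Qed.

(** Pair the left Perron vector with the constant vector 1. Each [l i] is multiplied by
    [(m i)^-1 <= 1], strictly less than 1 at a leaky type. *)
Lemma rho0_lt1 (R : realType) (d p : nat)
    (c : 'rV[int]_d -> 'I_p -> 'I_p -> R) (m : 'I_p -> R) :
  (0 < d)%N -> (0 < p)%N -> (forall x i j, 0 <= c x i j) ->
  (forall i, 1 <= m i) -> (forall i, 0 < sigma c i /\ sigma c i < +oo)%E ->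
  assumption_A c m -> rho c m 0 < 1.
Proof.
move=> d0 p0 c0 m1 sc hA.
have M0 i j : 0 <= Lmu c m 0 i j by exact: Lmu_ge0.
have [l [_ [l0 _ lA _]]] := perron_frobenius p0 M0 (Lmu_irreducible 0 d0 c0 m1 hA).
have suml0 : 0 < \sum_i l i.
  by rewrite (bigD1 (Ordinal p0))//= ltr_wpDr// sumr_ge0// => i _; exact: ltW.
rewrite -(ltr_pM2r suml0) mul1r /rho mulr_sumr.
under eq_bigr do rewrite -lA.
rewrite exchange_big /=.
under eq_bigr do rewrite -mulr_sumr sum_Lmu0//.
have [i0 mi0] := A_leaky hA.
have le_l i : l i / m i <= l i.
  by rewrite ger_pMr// invf_le1// (lt_le_trans ltr01).
rewrite (bigD1 i0)//= [ltRHS](bigD1 i0)//= ltr_leD ?ler_sum//.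
by rewrite gtr_pMr// invf_lt1// (lt_trans ltr01).
Qed.

(** A path from [(0, i0)] to [(x, i0)] bounds [kappa * expR (dotv t x)] by a diagonal entry of a
    power of [Lmu], itself at most 1 when [rho <= 1]. Signed basis vectors for [x] bound every
    coordinate of [t]. *)
Lemma rho_le1_bounded (R : realType) (d p : nat)
    (c : 'rV[int]_d -> 'I_p -> 'I_p -> R) (m : 'I_p -> R) :
  (0 < d)%N -> (0 < p)%N -> (forall x i j, 0 <= c x i j) ->
  (forall i, 1 <= m i) -> assumption_A c m ->
  exists B : R, forall t, rho c m t <= 1 -> `|t| <= B.
Proof.
move=> d0 p0 c0 m1 hA; pose i0 := Ordinal p0.
have dot_le (x : 'rV[int]_d) : exists B : R, forall t : 'rV[R]_d,
    rho c m t <= 1 -> dotv t (zvec R x) <= B.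
  have [n [_ Pn]] := A_irreducible hA i0 i0 x.
  have [kappa k0 kP] := Lmu_pow_ge d0 c0 m1 hA Pn.
  exists (- ln kappa) => t t1.
  have M0 i j : 0 <= Lmu c m t i j by exact: Lmu_ge0.
  have [_ [r [_ r0 _ Ar]]] := perron_frobenius p0 M0 (Lmu_irreducible t d0 c0 m1 hA).
  (* The right Perron vector is superharmonic since [rho <= 1], hence so it is for all powers. *)
  have rpow i k : \sum_j (Lmu c m t ^+ k) i j * r j <= r i.
    elim: k i => [|k IH] i.
      rewrite expr0 (bigD1 i)//= mxE eqxx mul1r big1 ?addr0// => j ij.
      by rewrite mxE eq_sym (negPf ij) mul0r.
    under eq_bigr do rewrite exprS mxE mulr_suml.
    rewrite exchange_big /=.
    apply: le_trans (_ : \sum_j Lmu c m t i j * r j <= _).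
      apply: ler_sum => j _; under eq_bigr do rewrite -mulrA.
      by rewrite -mulr_sumr ler_wpM2l.
    by rewrite Ar ler_piMl// ltW.
  have le1 : (Lmu c m t ^+ n) i0 i0 <= 1.
    rewrite -(ler_pM2r (r0 i0)) mul1r; apply: le_trans (rpow i0 n).
    rewrite [leRHS](bigD1 i0)//= lerDl sumr_ge0// => j _.
    by rewrite mulr_ge0 ?exprmx_ge0// ltW.
  have := le_trans (kP t) le1; rewrite subr0.
  rewrite -{1}(lnK k0) -expRD -expR0 ler_expR; lra.
have /choice[Bp BpP] (k : 'I_d) := dot_le (delta_mx ord0 k).
have /choice[Bn BnP] (k : 'I_d) := dot_le (- delta_mx ord0 k).
exists (\sum_k (`|Bp k| + `|Bn k|)) => t t1.
have dotE (k : 'I_d) : dotv t (zvec R (delta_mx ord0 k)) = t ord0 k.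
  rewrite /dotv (bigD1 k)//= !mxE !eqxx mulr1 big1 ?addr0// => j jk.
  by rewrite !mxE (negPf jk) andbF mulr0.
have dotNE (k : 'I_d) : dotv t (zvec R (- delta_mx ord0 k)) = - t ord0 k.
  rewrite -dotE /dotv -sumrN; apply: eq_bigr => j _.
  by rewrite !mxE intrN mulrN.
rewrite [leLHS]/Num.Def.normr/= mx_normrE.
apply: bigmax_le => [|[i k] _]; first by rewrite sumr_ge0// => k _; rewrite addr_ge0.
rewrite ord1 /= (bigD1 k)//= -[leLHS]addr0 lerD//; last first.
  by rewrite sumr_ge0// => j _; rewrite addr_ge0.
rewrite ler_norml.
have := BpP k t t1; have := BnP k t t1; rewrite dotE dotNE.
have := ler_norm (Bp k); have := ler_norm (Bn k).
have := normr_ge0 (Bp k); have := normr_ge0 (Bn k); lra.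
Qed.

Lemma rho_expansion (R : realType) (d p : nat)
    (c : 'rV[int]_d -> 'I_p -> 'I_p -> R) (m : 'I_p -> R) t :
  (0 < d)%N -> (0 < p)%N -> (forall x i j, 0 <= c x i j) ->
  (forall i, 1 <= m i) -> assumption_A c m ->
  exists (g : 'rV[R]_d) (C : R), forall v : 'rV[R]_d,
    rho c m t + dotv g v <= rho c m (t + v) /\
    (`|v| <= 1 -> rho c m (t + v) <= rho c m t + dotv g v + C * `|v| ^+ 2).
Proof.
move=> d0 p0 c0 m1 hA.
have mu0 i j x := mu_ge0 i j x c0 m1.
have mX i j := mu_exp_moments i j d0 c0 m1 hA.
pose D k := \matrix_(i < p, j < p) laplace_deriv (@zvec R d) (mu c m i j) t k.
have DE (v : 'rV[R]_d) i j : \sum_k v ord0 k * D k i j =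
    \sum_k v ord0 k * laplace_deriv (@zvec R d) (mu c m i j) t k.
  by apply: eq_bigr => k _; rewrite mxE.
apply: (@spectral_radius_expansion R d p (Lmu c m) D t p0).
- by move=> y i j; exact: Lmu_ge0.
- by move=> y; exact: Lmu_irreducible.
- by move=> v kappa i j; rewrite !LmuE// DE laplace_tangent.
move=> K.
have /choice[C CP] (ij : 'I_p * 'I_p) :=
  laplace_upper t K (mu0 ij.1 ij.2) (mX ij.1 ij.2).
exists (\sum_ij `|C ij|) => v kappa i j v1 kv.
rewrite !LmuE// DE; apply: le_trans (CP (i, j) v kappa v1 kv) _.
rewrite lerD2l ler_wpM2r ?sqr_ge0// (bigD1 (i, j))//=.
by apply: le_trans (ler_norm _) _; rewrite lerDl sumr_ge0.
Qed.

(** * Duality for sublevel sets *)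

Lemma dotvC (R : realType) (d : nat) (u v : 'rV[R]_d) : dotv u v = dotv v u.
Proof. by apply: eq_bigr => k _; rewrite mulrC. Qed.

Lemma dotvZl (R : realType) (d : nat) a (u v : 'rV[R]_d) :
  dotv (a *: u) v = a * dotv u v.
Proof. by rewrite mulr_sumr; apply: eq_bigr => k _; rewrite mxE mulrA. Qed.

Lemma dotvZr (R : realType) (d : nat) a (u v : 'rV[R]_d) :
  dotv u (a *: v) = a * dotv u v.
Proof. by rewrite dotvC dotvZl dotvC. Qed.

Lemma dotvNr (R : realType) (d : nat) (u v : 'rV[R]_d) :
  dotv u (- v) = - dotv u v.
Proof. by rewrite -scaleN1r dotvZr mulN1r. Qed.

Lemma dotvv_ge0 (R : realType) (d : nat) (u : 'rV[R]_d) : 0 <= dotv u u.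
Proof. by rewrite sumr_ge0// => k _; rewrite -expr2 sqr_ge0. Qed.

Lemma dotvv_eq0 (R : realType) (d : nat) (u : 'rV[R]_d) : dotv u u = 0 -> u = 0.
Proof.
move=> /psumr_eq0P u0; apply/matrixP => i k; rewrite ord1 mxE; apply/eqP.
by rewrite -sqrf_eq0 expr2; apply/eqP/u0 => // j _; rewrite -expr2 sqr_ge0.
Qed.

Lemma dotv0l (R : realType) (d : nat) (u : 'rV[R]_d) : dotv 0 u = 0.
Proof. by rewrite -(scale0r 0) dotvZl mul0r. Qed.

Lemma enormZ (R : realType) (d : nat) a (u : 'rV[R]_d) :
  enorm (a *: u) = `|a| * enorm u.
Proof.
by rewrite /enorm dotvZl dotvZr mulrA -expr2 sqrtrM ?sqr_ge0// sqrtr_sqr.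
Qed.

Lemma enorm_gt0 (R : realType) (d : nat) (u : 'rV[R]_d) : u != 0 -> 0 < enorm u.
Proof.
move=> un0; rewrite sqrtr_gt0 lt_neqAle dotvv_ge0 andbT eq_sym.
by apply: contra un0 => /eqP/dotvv_eq0/eqP.
Qed.

(** The lower bound is global and makes [g] a subgradient; the local upper bound makes [f]
    differentiable at [t]. *)
Definition quad_expansion (R : realType) (d : nat) (f : 'rV[R]_d -> R)
    (t g : 'rV[R]_d) (C : R) : Prop :=
  forall v : 'rV[R]_d, f t + dotv g v <= f (t + v) /\
    (`|v| <= 1 -> f (t + v) <= f t + dotv g v + C * `|v| ^+ 2).

Lemma quad_expansion_gradient (R : realType) (d : nat) (f : 'rV[R]_d -> R)
    (t g : 'rV[R]_d) (C : R) :
  quad_expansion f t g C -> gradient f t = g.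
Proof.
move=> fE; apply/matrixP => i k; rewrite ord1 mxE; apply/cvg_lim => //.
set e := delta_mx ord0 k : 'rV[R]_d.
have e1 : `|e| <= 1.
  rewrite [leLHS]/Num.Def.normr/= mx_normrE; apply: bigmax_le => // -[a b] _ /=.
  by rewrite mxE; case: (_ && _); rewrite ?normr1 ?normr0.
have ge : dotv g e = g ord0 k.
  rewrite /dotv (bigD1 k)//= mxE !eqxx mulr1 big1 ?addr0// => j jk.
  by rewrite mxE (negPf jk) andbF mulr0.
apply/cvgrPdist_le => eps eps0.
(* The difference quotient is within [|C| * |h|] of [g ord0 k]; adding 1 avoids a zero
   denominator. *)
have C0 : 0 < eps / (`|C| + 1) by rewrite divr_gt0// ltr_wpDl.
near=> h.
have h0 : h != 0 by near: h; exact: nbhs_dnbhs_neq.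
have h1 : `|h| <= 1.
  by near: h; apply: dnbhs0_le; exact: ltr01.
have hC : `|h| <= eps / (`|C| + 1) by near: h; exact: dnbhs0_le.
have he : `|h *: e| <= `|h| by rewrite normrZ ler_piMr.
have [low /(_ (le_trans he h1)) up] := fE (h *: e).
rewrite /= [h *: e + t]addrC -[_ *: _]/(h^-1 * (f (t + h *: e) - f t)).
have -> : g ord0 k - h^-1 * (f (t + h *: e) - f t) =
    - (h^-1 * (f (t + h *: e) - f t - dotv g (h *: e))).
  by rewrite dotvZr ge; field.
rewrite normrN normrM normfV ler_pdivrMl ?normr_gt0//.
rewrite ger0_norm; last by lra.
apply: le_trans (_ : `|C| * `|h| ^+ 2 <= _).
  apply: le_trans (_ : `|C| * `|h *: e| ^+ 2 <= _).
    have := ler_wpM2r (sqr_ge0 `|h *: e|) (ler_norm C); lra.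
  by rewrite ler_wpM2l// lerXn2r ?nnegrE.
rewrite expr2 mulrCA ler_wpM2l//.
move: hC; rewrite ler_pdivlMr ?ltr_wpDl// => hC.
by have := normr_ge0 h; nra.
Unshelve. all: by end_near. Qed.

Lemma quad_expansion_continuous (R : realType) (d : nat) (f : 'rV[R]_d -> R) :
  (forall t, exists g C, quad_expansion f t g C) -> continuous f.
Proof.
move=> fE t; have [g [C fgC]] := fE t.
(* A local Lipschitz constant at [t], since [|v|^2 <= |v|] for [|v| <= 1]. *)
pose K := l1norm g + `|C| + 1.
have K0 : 0 < K by rewrite ltr_wpDl ?addr_ge0 ?l1norm_ge0.
apply/(@cvgrPdist_le _ _ _ (nbhs t) (nbhs_filter t)) => eps eps0.
have eK : 0 < Num.min 1 (eps / K) by rewrite lt_min ltr01 divr_gt0.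
apply/nbhs_ballP; exists (Num.min 1 (eps / K)) => // s.
rewrite -ball_normE /= distrC => /ltW sD.
have : `|s - t| <= 1 by apply: le_trans sD _; rewrite ge_min lexx.
have : `|s - t| <= eps / K by apply: le_trans sD _; rewrite ge_min lexx orbT.
have [low up] := fgC (s - t); move: low up; rewrite [t + _]addrC subrK.
set v := s - t => low up ve v1; have {}up := up v1.
have gv := ler_norm_dotv v g; rewrite dotvC in gv.
move: ve; rewrite ler_pdivlMr// /K => ve.
have vv : `|v| ^+ 2 <= `|v| by rewrite expr2 ler_piMr.
have := ler_wpM2l (normr_ge0 C) vv.
have := ler_wpM2r (sqr_ge0 `|v|) (ler_norm C).
have := normr_ge0 v; have := l1norm_ge0 g; have := normr_ge0 C.
move: gv; rewrite !ler_norml => /andP[gv1 gv2]; nra.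
Qed.

Lemma interior_step (R : realType) (d : nat) (K : set 'rV[R]_d) t u :
  interior K t -> exists2 h : R, 0 < h & K (t + h *: u).
Proof.
move=> /nbhs_ballP[e /= e0 eK]; exists (e / 2 / (`|u| + 1)).
  by rewrite !divr_gt0// ltr_wpDl.
apply: eK; rewrite -ball_normE /= opprD addrA subrr add0r normrN normrZ.
rewrite ger0_norm ?divr_ge0 ?(ltW e0)// mulrAC ltr_pdivrMr ?ltr_wpDl//.
by have := normr_ge0 u; nra.
Qed.

Lemma descent_step (R : realType) (d : nat) (f : 'rV[R]_d -> R)
    (t g v : 'rV[R]_d) (C : R) :
  quad_expansion f t g C -> dotv g v < 0 ->
  exists2 h : R, 0 < h & f (t + h *: v) <= f t.
Proof.
(* A step below [a] stays where the upper bound holds; below [b] the quadratic error is beaten by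
   the linear decrease. *)
move=> fE gv; pose a := 1 / (`|v| + 1).
pose b := - dotv g v / (`|C| * `|v| ^+ 2 + 1).
have v1 : 0 < `|v| + 1 by rewrite ltr_wpDl.
have c1 : 0 < `|C| * `|v| ^+ 2 + 1 by rewrite ltr_wpDl// mulr_ge0 ?sqr_ge0.
pose h := Num.min a b.
have h0 : 0 < h by rewrite lt_min !divr_gt0// oppr_gt0.
exists h => //; have hv : `|h *: v| = h * `|v| by rewrite normrZ gtr0_norm.
have ha : h * (`|v| + 1) <= 1 by rewrite -ler_pdivlMr// ge_min lexx.
have hb : h * (`|C| * `|v| ^+ 2 + 1) <= - dotv g v.
  by rewrite -ler_pdivlMr// ge_min lexx orbT.
have hv1 : `|h *: v| <= 1 by rewrite hv; lra.
have [_ /(_ hv1)] := fE (h *: v); rewrite dotvZr hv => up.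
apply: le_trans up _; rewrite -addrA gerDl.
have := ler_wpM2r (sqr_ge0 `|v|) (ler_norm C) => CC.
have -> : h * dotv g v + C * (h * `|v|) ^+ 2 = h * (dotv g v + h * (C * `|v| ^+ 2)).
  by ring.
by rewrite pmulr_rle0//; nra.
Qed.

(** Let [q] be the part of [z] orthogonal to [g]. For every [e > 0] the direction [q - e *: g] is a
    descent direction, hence enters the sublevel set, and normality gives
    [dotv q q <= e * dotv z g]. Let [e] tend to 0. *)
Lemma normal_cone_ray (R : realType) (d : nat) (f : 'rV[R]_d -> R)
    (t g z : 'rV[R]_d) (C : R) :
  quad_expansion f t g C -> f t = 1 -> g != 0 ->
  normal_cone [set s | f s <= 1] t z -> exists a : R, z = a *: g.
Proof.
move=> fE ft1 gn0 zN; pose a := dotv z g / dotv g g; exists a.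
have gg0 : 0 < dotv g g.
  rewrite lt_neqAle dotvv_ge0 andbT eq_sym.
  by apply: contra gn0 => /eqP/dotvv_eq0/eqP.
pose q := z - a *: g.
have qg : dotv q g = 0.
  by rewrite /q dotvDl -scaleNr dotvZl /a; field; rewrite gt_eqF.
have zq : dotv z q = dotv q q.
  by rewrite -[X in dotv X q](subrK (a *: g)) -/q dotvDl dotvZl (dotvC g) qg; ring.
have small (e : R) : 0 < e -> dotv q q <= e * dotv z g.
  move=> e0; have gv : dotv g (q - e *: g) < 0.
    by rewrite dotvDr dotvNr dotvZr dotvC qg sub0r oppr_lt0 mulr_gt0.
  have [h h0 fh] := descent_step fE gv.
  have := zN (t + h *: (q - e *: g)); rewrite /= -ft1 => /(_ fh).
  rewrite addrAC subrr add0r dotvZr pmulr_rle0// dotvDr dotvNr dotvZr zq; lra.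
apply/eqP; rewrite -subr_eq0 -/q; apply/eqP/dotvv_eq0/eqP.
rewrite eq_le dotvv_ge0 andbT; apply/ler_addgt0Pl => e e0.
have k0 : 0 < `|dotv z g| + 1 by rewrite ltr_wpDl.
apply: le_trans (small (e / (`|dotv z g| + 1)) (divr_gt0 e0 k0)) _.
rewrite addr0 mulrAC ler_pdivrMr// ler_pM2l//.
by have := ler_norm (dotv z g); lra.
Qed.

(** For [f := rho c m], this and the next two definitions are convertible to [Gamma], [bdT] and
    [calT]. *)
Definition gauss_map (R : realType) (d : nat) (f : 'rV[R]_d -> R)
    (t : 'rV[R]_d) : 'rV[R]_d :=
  (enorm (gradient f t))^-1 *: gradient f t.

Definition level_set (R : realType) (d : nat) (f : 'rV[R]_d -> R) :
    set 'rV[R]_d := [set t | f t = 1].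

Definition sublevel_set (R : realType) (d : nat) (f : 'rV[R]_d -> R) :
    set 'rV[R]_d := [set t | f t <= 1].

Definition quad_expandable (R : realType) (d : nat) (f : 'rV[R]_d -> R) : Prop :=
  forall t, exists g C, quad_expansion f t g C.

(** * Gradient, frontier and Gauss map of a sublevel set *)

Lemma quad_expandable_gradient (R : realType) (d : nat) (f : 'rV[R]_d -> R) t :
  quad_expandable f -> exists C, quad_expansion f t (gradient f t) C.
Proof.
by move=> /(_ t)[g [C fE]]; exists C; rewrite (quad_expansion_gradient fE).
Qed.

Lemma gradient_tangent (R : realType) (d : nat) (f : 'rV[R]_d -> R) t s :
  quad_expandable f -> f t + dotv (gradient f t) (s - t) <= f s.
Proof.
move=> /(quad_expandable_gradient t)[C fE].
by have [] := fE (s - t); rewrite [t + (s - t)]addrC subrK.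
Qed.

Lemma gradient_dot_gt0 (R : realType) (d : nat) (f : 'rV[R]_d -> R) t :
  quad_expandable f -> f 0 < 1 -> f t = 1 -> 0 < dotv (gradient f t) t.
Proof.
move=> fE f0 ft; have := gradient_tangent t 0 fE.
by rewrite sub0r dotvNr ft; lra.
Qed.

Lemma gradient_neq0 (R : realType) (d : nat) (f : 'rV[R]_d -> R) t :
  quad_expandable f -> f 0 < 1 -> f t = 1 -> gradient f t != 0.
Proof.
move=> fE f0 ft; apply/eqP => g0.
by have := gradient_dot_gt0 fE f0 ft; rewrite g0 dotv0l ltxx.
Qed.

Lemma sublevel_set_closed (R : realType) (d : nat) (f : 'rV[R]_d -> R) :
  quad_expandable f -> closed (sublevel_set f).
Proof.
move=> /quad_expansion_continuous cf; apply: closed_ge_fun => //.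
exact: cst_continuous.
Qed.

Lemma sublt1_interior (R : realType) (d : nat) (f : 'rV[R]_d -> R) t :
  quad_expandable f -> f t < 1 -> interior (sublevel_set f) t.
Proof.
move=> /quad_expansion_continuous cf ft.
have := cf t [set y | y <= 1]; rewrite /nbhs /=; apply.
by apply: filterS (lt_nbhsl ft) => y /ltW.
Qed.

Lemma frontier_sublevel_set (R : realType) (d : nat) (f : 'rV[R]_d -> R) :
  quad_expandable f -> f 0 < 1 ->
  frontier (sublevel_set f) = level_set f.
Proof.
move=> fE f0; rewrite /frontier -(closure_id _).1; last exact: sublevel_set_closed.
apply/seteqP; split => t /=.
  move=> [ft nint]; apply/eqP; rewrite eq_le; apply/andP; split => //.
  by rewrite leNgt; apply/negP => /(sublt1_interior fE).
move=> ft; split; first by rewrite /sublevel_set /= ft.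
(* Moving radially outward from the level set makes [f] exceed 1, as the gradient has a positive
   product with [t]. *)
move=> /(interior_step t)[h h0]; rewrite /sublevel_set /= => fh.
have := le_trans (gradient_tangent t _ fE) fh.
rewrite addrAC subrr add0r dotvZr ft gerDl pmulr_rle0//.
by rewrite leNgt gradient_dot_gt0.
Qed.

Lemma enorm_gauss_map (R : realType) (d : nat) (f : 'rV[R]_d -> R) t :
  quad_expandable f -> f 0 < 1 -> f t = 1 -> enorm (gauss_map f t) = 1.
Proof.
move=> fE f0 ft; have g0 := enorm_gt0 (gradient_neq0 fE f0 ft).
by rewrite enormZ gtr0_norm ?invr_gt0// mulVf// gt_eqF.
Qed.

Lemma gauss_map_normal (R : realType) (d : nat) (f : 'rV[R]_d -> R) t :
  quad_expandable f -> f t = 1 -> normal_cone (sublevel_set f) t (gauss_map f t).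
Proof.
move=> fE ft s /= fs; rewrite dotvZl mulr_ge0_le0 ?invr_ge0 ?sqrtr_ge0//.
by have := gradient_tangent t s fE; rewrite ft; move: fs; rewrite /sublevel_set/=; lra.
Qed.

Lemma gauss_map_dot_gt0 (R : realType) (d : nat) (f : 'rV[R]_d -> R) t :
  quad_expandable f -> f 0 < 1 -> f t = 1 -> 0 < dotv (gauss_map f t) t.
Proof.
move=> fE f0 ft; have g0 := enorm_gt0 (gradient_neq0 fE f0 ft).
by rewrite dotvZl mulr_gt0 ?invr_gt0// gradient_dot_gt0.
Qed.

(** Both sides are the value of the support function in the common normal direction. This compares
    [t] with the preimage that [pinv] selects. *)
Lemma gauss_map_dot_eq (R : realType) (d : nat) (f : 'rV[R]_d -> R) s t :
  quad_expandable f -> f s = 1 -> f t = 1 -> gauss_map f s = gauss_map f t ->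
  dotv (gauss_map f t) s = dotv (gauss_map f t) t.
Proof.
move=> fE fs ft st; apply/eqP; rewrite eq_le; apply/andP; split.
  have /(_ s) := gauss_map_normal fE ft; rewrite /sublevel_set/= fs => /(_ (lexx _)).
  by rewrite dotvDr dotvNr subr_le0.
have /(_ t) := gauss_map_normal fE fs; rewrite /sublevel_set/= ft => /(_ (lexx _)).
by rewrite dotvDr dotvNr subr_le0 st.
Qed.

(** The normal cone lies on the line of the gradient, and the condition [dotv z t = 1] fixes the
    multiple. *)
Lemma dual_points_gauss_map (R : realType) (d : nat) (f : 'rV[R]_d -> R) t z :
  quad_expandable f -> f 0 < 1 -> f t = 1 ->
  dual_points (sublevel_set f) t z <->
  z = (dotv (gauss_map f t) t)^-1 *: gauss_map f t.
Proof.
move=> fE f0 ft; have gt0 := gauss_map_dot_gt0 fE f0 ft; split; last first.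
  move=> ->; split; last by rewrite dotvZl mulVf// gt_eqF.
  move=> s fs; rewrite dotvZl mulr_ge0_le0 ?invr_ge0 ?(ltW gt0)//.
  exact: gauss_map_normal.
move=> [zN zt]; have [C fC] := quad_expandable_gradient t fE.
have gn0 := gradient_neq0 fE f0 ft; have e0 := enorm_gt0 gn0.
have [a za] := normal_cone_ray fC ft gn0 zN.
have dg0 := gradient_dot_gt0 fE f0 ft.
rewrite /gauss_map dotvZl scalerA za invfM invrK mulrAC mulfV ?gt_eqF// mul1r.
congr (_ *: _); apply: (mulIf (lt0r_neq0 dg0)).
by rewrite mulVf ?gt_eqF// -zt za dotvZl.
Qed.

(** A maximizer [t] of [dotv u] over the compact sublevel set lies on the frontier, and [u] is
    normal there. The rescaled [u] is therefore the unique dual point at [t]. *)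
Lemma gauss_map_surj (R : realType) (d : nat) (f : 'rV[R]_d -> R) (B : R) u :
  quad_expandable f -> f 0 < 1 -> (forall t, f t <= 1 -> `|t| <= B) ->
  enorm u = 1 -> exists2 t, f t = 1 & gauss_map f t = u.
Proof.
move=> fE f0 fB u1.
have uu : dotv u u = 1.
  by have := sqr_sqrtr (dotvv_ge0 u); rewrite -/(enorm u) u1 expr1n.
have cT : compact (sublevel_set f).
  apply: bounded_closed_compact; last exact: sublevel_set_closed.
  exists B; split; first exact: num_real.
  by move=> M BM t /fB /le_trans; apply; exact: ltW.
have T0 : sublevel_set f !=set0 by exists 0; exact: ltW.
have cu : continuous (fun t : 'rV[R]_d => dotv u t).
  apply: quad_expansion_continuous => t; exists u, 0 => v.
  by rewrite dotvDr mul0r addr0.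
have [t /set_mem tT tmax] := compact_EVT_max T0 cT (continuous_subspaceT cu).
have {}tmax s : f s <= 1 -> dotv u s <= dotv u t.
  by move=> fs; apply: tmax; rewrite inE.
have ft : f t = 1.
  suff : frontier (sublevel_set f) t by rewrite frontier_sublevel_set.
  split; first exact: subset_closure.
  move=> /(interior_step u)[h h0 /tmax].
  by rewrite dotvDr dotvZr uu mulr1 gerDl leNgt h0.
(* The set contains a small positive multiple of [u], since 0 is interior. *)
have ut : 0 < dotv u t.
  have [h h0] := interior_step u (sublt1_interior fE f0).
  by rewrite add0r => /tmax; apply: lt_le_trans; rewrite dotvZr uu mulr1.
exists t => //.
have /(dual_points_gauss_map _ fE f0 ft) : dual_points (sublevel_set f) t
    ((dotv u t)^-1 *: u).
  split; last by rewrite dotvZl mulVf// gt_eqF.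
  move=> s fs; rewrite dotvZl mulr_ge0_le0 ?invr_ge0 ?(ltW ut)//.
  by rewrite dotvDr dotvNr subr_le0 tmax.
have g0 := gauss_map_dot_gt0 fE f0 ft.
(* Two unit vectors with equal positive multiples: comparing norms identifies the factors, then the
   vectors. *)
move=> E; have := congr1 (@enorm R d) E.
rewrite enormZ u1 [RHS]enormZ enorm_gauss_map// !mulr1 !gtr0_norm ?invr_gt0// => Ei.
by move: E; rewrite Ei => /(scalerI _)->//; rewrite invr_eq0 gt_eqF.
Qed.

Lemma dual_curve_sublevel_set (R : realType) (d : nat) (f : 'rV[R]_d -> R)
    (B : R) :
  quad_expandable f -> f 0 < 1 -> (forall t, f t <= 1 -> `|t| <= B) ->
  [set (dotv (pinv (level_set f) (gauss_map f) u) u)^-1 *: u |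
    u in @unit_sphere R d] = dual_curve (sublevel_set f).
Proof.
move=> fE f0 fB; rewrite /dual_curve frontier_sublevel_set//.
(* By surjectivity onto the sphere, [pinv] returns a genuine preimage in the level set and not its
   default value. *)
have pinvP u : enorm u = 1 ->
    f (pinv (level_set f) (gauss_map f) u) = 1 /\
    gauss_map f (pinv (level_set f) (gauss_map f) u) = u.
  move=> /(gauss_map_surj fE f0 fB)[t ft gt].
  have ui : (gauss_map f @` level_set f) u by exists t.
  split; last by apply: pinvK; rewrite inE.
  have surj : set_surj (level_set f) (gauss_map f @` level_set f) (gauss_map f).
    by [].
  by apply: (@surjpinv_image_sub _ _ (fun=> point) _ _ _ surj); exists u.
apply/seteqP; split => z /=.
  move=> [u u1 <-]; have [ft gt] := pinvP u u1.
  exists (pinv (level_set f) (gauss_map f) u) => //.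
  by apply/(dual_points_gauss_map _ fE f0 ft); rewrite gt dotvC.
move=> [t /= ft] /(dual_points_gauss_map _ fE f0 ft) ->.
have u1 := enorm_gauss_map fE f0 ft.
exists (gauss_map f t) => //; have [fs gs] := pinvP _ u1.
by rewrite dotvC (gauss_map_dot_eq fE fs ft gs).
Qed.

Theorem proposition32 (R : realType) (d p : nat)
    (hd : (1 <= d)%N) (hp : (1 <= p)%N)
    (c : 'rV[int]_d -> 'I_p -> 'I_p -> R) (m : 'I_p -> R)
    (hc : forall (x : 'rV[int]_d) (i j : 'I_p), 0 <= c x i j)
    (hsigma : forall i : 'I_p, (0 < sigma c i)%E /\ (sigma c i < +oo)%E)
    (hm : forall i : 'I_p, 1 <= m i)
    (hA : assumption_A c m) :
  limit_curve c m = dual_curve (calT c m).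
Proof.
have [B rhoB] := rho_le1_bounded hd hp hc hm hA.
apply: (dual_curve_sublevel_set _ _ rhoB); last exact: rho0_lt1.
by move=> t; exact: rho_expansion.
Qed.
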